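(* Let $M\ge 3$, $2<K<\frac{M}{2}$, and let $\mathcal{S}$ be the collection of all subsets of $\{1,\dots,M\}$ of size at most $K$. Consider the outlier hypothesis testing problem with identical outliers described in the context, in the setting where only $\pi$ is known (and $\mu$ is unknown). For each threshold $T$, let $(N^*,\delta^* )$ be the test with parameter $T$ described in the context, and let $P_{\max}$ be its maximal error probability. Then this test is universally consistent as $T\to\infty$, and for all $\mu,\pi\in\mathcal{P}(\mathcal{Y})$ with full support and $\mu\neq\pi$ it satisfies, for every $T$, $$P_{\max}\le \frac{C}{T},$$ where $C$ is a constant that depends only on $M,K,\mu,\pi$, but not on $T$. In addition, for each non-null hypothesis $S\in\mathcal{S}$, $S\ne\emptyset$, as $T\to\infty$, $$\mathbb{E}_S[N^*]\le \frac{\log T}{\alpha_S}(1+o(1))\le \begin{cases}\dfrac{-\log P_{\max}}{D(\mu\|\pi)}(1+o(1)), & |S|=K,\\[2mm] \dfrac{-\log P_{\max}}{\min\left(D(\mu\|\pi),\,\eta_S(\mu\|\pi)\right)}(1+o(1)), & 1\le |S|<K,\end{cases}$$ where $$\alpha_S \triangleq \min_{S'\in\mathcal{S},\,S'\ne S,\,S'\neq\emptyset}\Big[\,|S\cap S'|\,D\Big(\mu\,\Big\|\,\tfrac{|S\cap S'|\mu+|S'\setminus S|\pi}{|S'|}\Big)+|S\setminus S'|\,D(\mu\|\pi)+|S'\setminus S|\,D\Big(\pi\,\Big\|\,\tfrac{|S\cap S'|\mu+|S'\setminus S|\pi}{|S'|}\Big)\Big]>0$$ and $$\eta_S(\mu\|\pi)\triangleq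 \min_{p\in\mathcal{P}(\mathcal{Y})}\ |S|\,D(\mu\|p)+D(\pi\|p).$$
   Context: All logarithms are natural. $\mathcal{Y}$ is a finite known set, $\mathcal{P}(\mathcal{Y})$ is the set of probability distributions on $\mathcal{Y}$, and $D(p\|q)=\sum_{y\in\mathcal{Y}}p(y)\log\frac{p(y)}{q(y)}$ is relative entropy. Model. There are $M\ge 3$ independent sequences of observations; $Y^{(i)}_k\in\mathcal{Y}$ is the $k$-th observation of the $i$-th sequence, and each sequence is i.i.d. There are at most $K$ outliers, $2<K<M/2$. Let $\mu,\pi\in\mathcal{P}(\mathcal{Y})$ have full support, $\mu\ne\pi$ (otherwise arbitrary). Under the hypothesis $S\in\mathcal{S}$ ($S$ is the set of all outliers), sequences $i\in S$ are i.i.d. $\mu$ and sequences $j\notin S$ are i.i.d. $\pi$, so the first $n$ observations $\mathbf{y}^n$ of all sequences have joint law $$p_S(\mathbf{y}^n)=\prod_{k=1}^n\Big\{\prod_{i\in S}\mu(y^{(i)}_k)\prod_{j\notin S}\pi(y^{(j)}_k)\Big\}.$$ $S=\emptyset$ is the null hypothesis. $\mathbb{P}_S,\mathbb{E}_S$ denote probability and expectation under hypothesis $S$. A sequential test is a pair $(N,\delta)$ of a stopping time $N$ and a decision rule $\delta$ which, on $N=n$, maps the first $n$ observations of all sequences to an element of $\mathcal{S}$. Its maximal error probability is $P_{\max}=\max_{S\in\mathcal{S}}\mathbb{P}_S\{\delta(\mathbf{Y}^N)\ne S\}$. A family of tests indexed by $T$ is universally consistent if $P_{\max}\to0$ as $T\to\infty$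 for all $\mu,\pi$ with $\mu\ne\pi$. The test. At time $n$ let $\gamma_i$ be the empirical distribution of the first $n$ observations of sequence $i$. For nonempty $S\in\mathcal{S}$ put $$G_n(S)=\sum_{i\in S}D\Big(\gamma_i\,\Big\|\,\tfrac{1}{|S|}\sum_{k\in S}\gamma_k\Big)+\sum_{j\notin S}D(\gamma_j\|\pi),$$ and let $\hat S=\hat S(\mathbf{Y}^n)\in\operatorname{argmin}_{S\in\mathcal{S},S\ne\emptyset}G_n(S)$ (equivalently, the maximizer over nonempty $S \in \mathcal S$ of the generalized likelihood obtained from $p_S$ by replacing $\mu$ with $\frac{1}{|S|}\sum_{i\in S}\gamma_i$). Let $\tilde N$ be the smallest $n\ge1$ such that $$\min_{S'\in\mathcal{S},\,S'\ne\hat S,\,S'\ne\emptyset}\ n\big[G_n(S')-G_n(\hat S)\big]>\log T+(M+1)|\mathcal{Y}|\log(n+1).$$ Let $f(T)$ be any function growing at least as fast as $T\log T$. The test is $N^*=\min(\tilde N,\lfloor f(T)\rfloor)$, with $\delta^*=\hat S(\mathbf{Y}^{N^*})$ if $\tilde N\le f(T)$, and $\delta^*=\emptyset$ (the null hypothesis) if $\tilde N>f(T)$. *)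

(* Defs.v *)
From mathcomp Require Import all_boot all_order all_algebra.
From mathcomp Require Import all_classical all_reals all_analysis.
Set Implicit Arguments.
Unset Strict Implicit.
Unset Printing Implicit Defensive.
Import Order.TTheory GRing.Theory Num.Theory.
Import numFieldNormedType.Exports.
Local Open Scope classical_set_scope.
Local Open Scope ring_scope.

(** Sequential outlier hypothesis testing with identical outliers, when the
    typical distribution [pi] is known and the outlier distribution [mu] is not
    (MathComp-Analysis over an arbitrary [R : realType]). *)

Definition is_dist (R : realType) (Y : finType) (p : Y -> R) : Prop :=
  (forall y, 0 <= p y) /\ \sum_(y : Y) p y = 1.

Definition full_support (R : realType) (Y : finType) (p : Y -> R) : Prop :=
  forall y, 0 < p y.

(* Relative entropy, with [0 log (0 / q) = 0] and [p log (p / 0) = +oo]. *)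
Definition KL (R : realType) (Y : finType) (p q : Y -> R) : \bar R :=
  (\sum_(y : Y)
     (if p y == 0%R then 0
      else if q y == 0%R then +oo
      else (p y * ln (p y / q y))%:E))%E.

Section Model.
Variables (R : realType) (Y : finType) (M : nat).

(* [x k i] is the observation number [k.+1] of sequence [i]. *)
Definition obs_path : Type := nat -> 'I_M -> Y.

Definition obs (n : nat) : finType := {ffun 'I_n * 'I_M -> Y}.

Definition first_obs (n : nat) (x : obs_path) : obs n :=
  [ffun ki : 'I_n * 'I_M => x ki.1 ki.2].

Definition hyps (K : nat) (S : {set 'I_M}) : bool := (#|S| <= K)%N.

Definition nonnull (K : nat) (S : {set 'I_M}) : bool :=
  hyps K S && (S != finset.set0).

Definition joint_law (mu pi : Y -> R) (S : {set 'I_M}) (n : nat) (y : obs n)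
    : R :=
  \prod_(k < n)
    ((\prod_(i in S) mu (y (k, i))) * (\prod_(j in ~: S) pi (y (k, j)))).

(* [X w] is the whole array of observations at the sample point [w], and [P S]
   is the probability under the hypothesis [S]. *)
Definition outlier_model (K : nat) (mu pi : Y -> R) (d : measure_display)
    (Omega : measurableType d) (P : {set 'I_M} -> probability Omega R)
    (X : Omega -> obs_path) : Prop :=
  (forall n (y : obs n), measurable [set w | first_obs n (X w) = y]) /\
  (forall S, hyps K S -> forall n (y : obs n),
     P S [set w | first_obs n (X w) = y] = (joint_law mu pi S y)%:E).

Definition Pmax (K : nat) (d : measure_display) (Omega : measurableType d)
    (P : {set 'I_M} -> probability Omega R) (X : Omega -> obs_path)
    (dec : obs_path -> {set 'I_M}) : R :=
  \big[Order.max/0]_(S | hyps K S) fine (P S [set w | dec (X w) != S]).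

(* The decision rules [dec pi T] of a family of tests indexed by [T] may use the
   known distribution [pi], but not [mu]. *)
Definition universally_consistent (K : nat)
    (dec : (Y -> R) -> R -> obs_path -> {set 'I_M}) : Prop :=
  forall mu pi : Y -> R,
    is_dist mu -> is_dist pi -> full_support mu -> full_support pi ->
    mu <> pi ->
  forall (d : measure_display) (Omega : measurableType d)
    (P : {set 'I_M} -> probability Omega R) (X : Omega -> obs_path),
    outlier_model K mu pi P X ->
    Pmax K P X (dec pi T) @[T --> +oo] --> (0 : R).

Definition empirical (n : nat) (y : obs n) (i : 'I_M) : Y -> R :=
  fun a => #|[pred k : 'I_n | y (k, i) == a]|%:R / n%:R.

Definition avg_empirical (n : nat) (y : obs n) (S : {set 'I_M}) : Y -> R :=
  fun a => #|S|%:R^-1 * \sum_(k in S) empirical y k a.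

Definition glr_cost (pi : Y -> R) (n : nat) (y : obs n) (S : {set 'I_M})
    : \bar R :=
  (\sum_(i in S) KL (empirical y i) (avg_empirical y S)
   + \sum_(j in ~: S) KL (empirical y j) pi)%E.

Definition estimator : Type := forall n : nat, obs n -> {set 'I_M}.

(* [shat] is one way of breaking ties in the argmin. *)
Definition argmin_estimator (K : nat) (pi : Y -> R) (shat : estimator) : Prop :=
  forall (n : nat) (y : obs n), (0 < n)%N ->
    nonnull K (shat n y) /\
    (forall S, nonnull K S ->
       (glr_cost pi y (shat n y) <= glr_cost pi y S)%E).

Definition threshold (T : R) (n : nat) : R :=
  ln T + M.+1%:R * #|Y|%:R * ln n.+1%:R.

Definition stops (K : nat) (pi : Y -> R) (shat : estimator) (T : R) (n : nat)
    (y : obs n) : bool :=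
  ((threshold T n)%:E <
   \big[Order.min/+oo]_(S' | nonnull K S' && (S' != shat n y))
      (n%:R%:E * (glr_cost pi y S' - glr_cost pi y (shat n y))))%E.

(* [None] stands for the value [+oo] of a stopping time. *)
Definition first_time (A : pred nat) : option nat :=
  match pselect (exists n, A n) with
  | left h => Some (ex_minn h)
  | right _ => None
  end.

Definition Ntilde (K : nat) (pi : Y -> R) (shat : estimator) (T : R)
    (x : obs_path) : option nat :=
  first_time (fun n => (0 < n)%N && stops K pi shat T (first_obs n x)).

(* [Num.truncn a] is the floor of [a] when [0 <= a], and [0] otherwise. *)
Definition Nstar (K : nat) (pi : Y -> R) (shat : estimator) (f : R -> R) (T : R)
    (x : obs_path) : nat :=
  match Ntilde K pi shat T x with
  | Some n => minn n (Num.truncn (f T))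
  | None => Num.truncn (f T)
  end.

Definition dstar (K : nat) (pi : Y -> R) (shat : estimator) (f : R -> R) (T : R)
    (x : obs_path) : {set 'I_M} :=
  match Ntilde K pi shat T x with
  | Some n => if n%:R <= f T
              then shat _ (first_obs (Nstar K pi shat f T x) x) else finset.set0
  | None => finset.set0
  end.

Definition mixture (mu pi : Y -> R) (S S' : {set 'I_M}) : Y -> R :=
  fun y => (#|S :&: S'|%:R * mu y + #|S' :\: S|%:R * pi y) / #|S'|%:R.

Definition alpha_S (K : nat) (mu pi : Y -> R) (S : {set 'I_M}) : \bar R :=
  (\big[Order.min/+oo]_(S' | nonnull K S' && (S' != S))
     (#|S :&: S'|%:R%:E * KL mu (mixture mu pi S S')
      + #|S :\: S'|%:R%:E * KL mu pi
      + #|S' :\: S|%:R%:E * KL pi (mixture mu pi S S')))%E.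

(* The infimum is a minimum, attained at [(#|S| mu + pi) / (#|S| + 1)]; it is
   taken in [\bar R] because [KL mu p] is infinite when [p] lacks full support. *)
Definition eta_S (mu pi : Y -> R) (S : {set 'I_M}) : \bar R :=
  ereal_inf [set (#|S|%:R%:E * KL mu p + KL pi p)%E | p in @is_dist R Y].

End Model.

(* [f] grows at least as fast as [T log T], with witnesses [c > 0] and [T0].
   For [c = T0 = 1] this is [T log T <= f T]; a bound valid for every [T] can
   only be uniform in [f] once [c] and [T0] are fixed, as [f] is free below
   [T0]. *)
Definition grows_TlnT (R : realType) (c T0 : R) (f : R -> R) : Prop :=
  forall T : R, T0 <= T -> c * (T * ln T) <= f T.

(* Main.v *)
Require Import Defs.
From mathcomp Require Import all_boot all_order all_algebra.
From mathcomp Require Import all_classical all_reals all_analysis.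
From mathcomp Require Import ring lra.
Set Implicit Arguments.
Unset Strict Implicit.
Unset Printing Implicit Defensive.
Import Order.TTheory GRing.Theory Num.Theory.
Import numFieldNormedType.Exports.
Local Open Scope classical_set_scope.
Local Open Scope ring_scope.

(** Write [D_n] for the sum over all sequences of the relative entropies of the
    empirical distributions after [n] steps with respect to the true laws
    ([emp_div]), and [G] for the real-valued cost ([glr]). The proof rests on the
    concentration of [D_n] and on deterministic comparisons of [G] with [D_n].

    Concentration. By the method of types, [n D_n] exceeds [l] with probability
    at most [exp (- l) (n + 1) ^ (M |Y|)] ([sum_joint_law_emp_div]).

    Errors. The common law that fits the sequences of [S] best is the average of
    their empirical distributions, so [G S <= D_n] for the true [S]
    ([glr_le_emp_div]); under the null hypothesis [G] is at most [D_n] at every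
    singleton. A stop at a wrong estimate therefore forces [n D_n] above the
    threshold ([wrong_stop_emp_div]), and the threshold is chosen so that these
    probabilities sum to at most [1 / T].

    Stopping. For any [S'], [G S'] is bounded below by a linear function of the
    empirical distributions which at the true laws equals the expression
    minimized in [alpha_S] ([glr_ge_linear]). Since relative entropy dominates
    the squared Hellinger distance, a small [D_n] makes the empirical
    distributions close to the true laws. Hence for every positive
    [b < alpha_S], once [n b] exceeds [ln T] plus a constant, the stopping
    condition holds unless [D_n] is larger than some fixed positive number
    ([stops_near_laws]), an event whose probability is summable in [n]. This gives [ln T / b + O(1)] for the expected
    sample size ([expected_size_bound]), hence [ln T / alpha_S (1 + o(1))], and
    it shows that the deadline, of order at least [T ln T], is missed with
    probability [O(1 / T)] ([prob_error_bound]).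

    Second bound. The exponent given by [KL mu pi] and [eta_S] is positive, by
    the comparison with the Hellinger distance, and at most [alpha_S]
    ([rate_S_le_alpha]); and [ln T] is at most [- ln Pmax] plus a constant, where
    [Pmax] is positive because all finite arrays of observations have positive
    probability ([Pmax_gt0]). *)

(** * Relative entropy and Hellinger distance *)

Lemma lnB_divl (R : realType) (a b c : R) : 0 < a -> 0 < b -> 0 < c ->
  ln (a / b) - ln (a / c) = ln (c / b).
Proof. by move=> a0 b0 c0; rewrite !ln_div ?posrE//; ring. Qed.

Lemma lnB_divr (R : realType) (a b c : R) : 0 < a -> 0 < b -> 0 < c ->
  ln (a / c) - ln (b / c) = ln (a / b).
Proof. by move=> a0 b0 c0; rewrite !ln_div ?posrE//; ring. Qed.

Lemma lnB_mul (R : realType) (a b c : R) : 0 < a -> 0 < b -> 0 < c ->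
  ln (a / b) - ln c = ln (a / (b * c)).
Proof.
by move=> a0 b0 c0; rewrite !ln_div ?posrE ?mulr_gt0// lnM ?posrE//; ring.
Qed.

Section RelativeEntropy.
Variables (R : realType) (Y : finType).
Implicit Types p q r : Y -> R.

(** Relative entropy dominates the squared Hellinger distance, in pointwise form:
    the term [a - b] cancels when summed over two distributions. *)
Lemma mulr_ln_ge_sqrt (a b : R) : 0 <= a -> 0 <= b -> (b = 0 -> a = 0) ->
  (Num.sqrt a - Num.sqrt b) ^+ 2 + (a - b) <= a * ln (a / b).
Proof.
move=> a0 b0 ba; have [->|an0] := eqVneq a 0.
  by rewrite mul0r sqrtr0 !sub0r sqrrN sqr_sqrtr// subrr.
have ap : 0 < a by rewrite lt_neqAle eq_sym an0.
have bp : 0 < b.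
  by rewrite lt_neqAle b0 andbT eq_sym; apply: contra_neq an0.
set s := Num.sqrt a; set t := Num.sqrt b.
have sp : 0 < s by rewrite sqrtr_gt0.
have tp : 0 < t by rewrite sqrtr_gt0.
have -> : a = s ^+ 2 by rewrite sqr_sqrtr.
have -> : b = t ^+ 2 by rewrite sqr_sqrtr.
(* [ln (a / b) = - 2 ln (t / s)] and [ln x <= x - 1] *)
have -> : s ^+ 2 / t ^+ 2 = (t / s) ^- 2.
  by field; rewrite !gt_eqF.
have lnle : ln (t / s) <= t / s - 1.
  have := @le_ln1Dx R (t / s - 1).
  by rewrite (addrC 1) subrK; apply; rewrite ltrBrDr addNr divr_gt0.
have -> : ln ((t / s) ^- 2) = - (2 * ln (t / s)).
  rewrite lnV ?posrE ?exprn_gt0 ?divr_gt0// lnXn ?divr_gt0//.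
  by rewrite mulr_natl.
have -> : (s - t) ^+ 2 + (s ^+ 2 - t ^+ 2) = s ^+ 2 * (- (2 * (t / s - 1))).
  by field; rewrite gt_eqF.
rewrite ler_pM2l ?exprn_gt0// lerN2 ler_pM2l//.
Qed.

Lemma mulr_ln_ge (a b : R) : 0 <= a -> 0 <= b -> (b = 0 -> a = 0) ->
  a - b <= a * ln (a / b).
Proof.
move=> a0 b0 ba; apply: le_trans (mulr_ln_ge_sqrt a0 b0 ba).
by rewrite lerDr sqr_ge0.
Qed.

(** Relative entropy as a real number; it agrees with [KL] when [p] vanishes
    wherever [q] does. *)
Definition klr p q : R := \sum_(y : Y) p y * ln (p y / q y).

(** Squared Hellinger distance, up to the customary factor [1 / 2]. *)
Definition hell p q : R := \sum_(y : Y) (Num.sqrt (p y) - Num.sqrt (q y)) ^+ 2.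

Lemma KL_klr p q : (forall y, q y = 0 -> p y = 0) -> KL p q = (klr p q)%:E.
Proof.
move=> pq; rewrite /KL /klr -sumEFin; apply: eq_bigr => y _.
case: (eqVneq (p y) 0) => [->|py]; first by rewrite mul0r.
by case: (eqVneq (q y) 0) => [/pq/eqP|//]; rewrite (negbTE py).
Qed.

Lemma KL_klr_full p q : full_support q -> KL p q = (klr p q)%:E.
Proof. by move=> q0; apply: KL_klr => y yq; have := q0 y; rewrite yq ltxx. Qed.

Lemma hell_ge0 p q : 0 <= hell p q.
Proof. by apply: sumr_ge0 => y _; apply: sqr_ge0. Qed.

Lemma sum_sub_dist p q : is_dist p -> is_dist q -> \sum_(y : Y) (p y - q y) = 0.
Proof. by move=> [_ p1] [_ q1]; rewrite sumrB p1 q1 subrr. Qed.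

Lemma KL_ge_hell p q : is_dist p -> is_dist q -> ((hell p q)%:E <= KL p q)%E.
Proof.
move=> dp dq; have [p0 _] := dp; have [q0 _] := dq.
rewrite -[hell p q]addr0 -(sum_sub_dist dp dq) -big_split /= -sumEFin.
apply: lee_sum => y _.
case: eqVneq => [->|py].
  by rewrite lee_fin sqrtr0 !sub0r sqrrN sqr_sqrtr// subrr.
case: eqVneq => [_|qy]; first by rewrite leey.
by rewrite lee_fin mulr_ln_ge_sqrt// => qy0; rewrite qy0 eqxx in qy.
Qed.

Lemma klr_ge_hell p q : is_dist p -> is_dist q -> full_support q ->
  hell p q <= klr p q.
Proof. by move=> dp dq fq; rewrite -lee_fin -KL_klr_full// KL_ge_hell. Qed.

Lemma klr_ge0 p q : is_dist p -> is_dist q -> full_support q -> 0 <= klr p q.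
Proof.
by move=> dp dq fq; apply: le_trans (klr_ge_hell dp dq fq); exact: hell_ge0.
Qed.

Lemma hell_gt0 p q : is_dist p -> is_dist q -> p <> q -> 0 < hell p q.
Proof.
move=> [p0 _] [q0 _] pq; rewrite lt_neqAle hell_ge0 andbT eq_sym.
apply/eqP => /eqP; rewrite psumr_eq0; last by move=> y _; apply: sqr_ge0.
move=> /allP h; apply: pq; apply/funext => y.
have := h y (mem_index_enum _); rewrite sqrf_eq0 subr_eq0 => /eqP.
by move=> e; rewrite -[p y]sqr_sqrtr// e sqr_sqrtr.
Qed.

(** From the parallelogram law. *)
Lemma hell_triangle p q r : hell p q <= 2 * (hell p r + hell q r).
Proof.
rewrite /hell -big_split /= mulr_sumr; apply: ler_sum => y _.
set a := Num.sqrt (p y); set b := Num.sqrt (q y); set c := Num.sqrt (r y).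
have : 0 <= (a + b - 2 * c) ^+ 2 by apply: sqr_ge0.
by move=> h; rewrite -subr_ge0 (_ : _ - _ = (a + b - 2 * c) ^+ 2)//; ring.
Qed.

Lemma dist_le1 p y : is_dist p -> p y <= 1.
Proof.
move=> [p0 <-]; rewrite (bigD1 y)//= lerDl; apply: sumr_ge0 => i _; exact: p0.
Qed.

Lemma dist_close_hell p q y : is_dist p -> is_dist q ->
  `|p y - q y| <= 2 * Num.sqrt (hell p q).
Proof.
move=> dp dq; have [p0 _] := dp; have [q0 _] := dq.
have -> : p y - q y = (Num.sqrt (p y) + Num.sqrt (q y)) *
    (Num.sqrt (p y) - Num.sqrt (q y)).
  by rewrite mulrC -subr_sqr !sqr_sqrtr.
rewrite normrM ler_pM//.
- rewrite ger0_norm ?addr_ge0 ?sqrtr_ge0// (_ : 2 = 1 + 1)//.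
  by apply: lerD; rewrite -[leRHS](@sqrtr1 R) ler_sqrt// dist_le1.
- rewrite -sqrtr_sqr ler_wsqrtr// /hell (bigD1 y)//= lerDl.
  by apply: sumr_ge0 => i _; apply: sqr_ge0.
Qed.

(** Two distributions on a set with at most one point are equal. *)
Lemma dist_neq_card p q : is_dist p -> is_dist q -> p <> q -> (1 < #|Y|)%N.
Proof.
move=> [_ p1] [_ q1] pq; rewrite ltnNge; apply/negP => /card_le1P Y1.
apply: pq; apply/funext => y.
have e (r : Y -> R) : \sum_(z : Y) r z = r y.
  rewrite (bigD1 y)//= big1 ?addr0// => z zy.
  by have := Y1 y isT z; rewrite !inE (negbTE zy).
by rewrite -[LHS]e -[RHS]e p1 q1.
Qed.

End RelativeEntropy.

(** * Empirical distributions and costs *)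

Section Costs.
Variables (R : realType) (Y : finType) (M : nat).
Implicit Types (mu pi : Y -> R) (S : {set 'I_M}).

(** The distribution of the observations of sequence [i] under [S]. *)
Definition seq_law mu pi S (i : 'I_M) : Y -> R := if i \in S then mu else pi.

Lemma seq_law_dist mu pi S i : is_dist mu -> is_dist pi ->
  is_dist (seq_law mu pi S i).
Proof. by rewrite /seq_law; case: ifP. Qed.

Lemma seq_law_full mu pi S i : full_support mu -> full_support pi ->
  full_support (seq_law mu pi S i).
Proof. by rewrite /seq_law; case: ifP. Qed.

Lemma joint_lawE mu pi S n (y : obs Y M n) :
  joint_law mu pi S y = \prod_(k < n) \prod_(i < M) seq_law mu pi S i (y (k, i)).
Proof.
apply: eq_bigr => k _; rewrite [RHS](bigID [in S])/=; congr (_ * _).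
- by apply: eq_bigr => i iS; rewrite /seq_law iS.
- apply: eq_big => [i|i]; first by rewrite finset.in_setC.
  by rewrite finset.in_setC /seq_law => /negbTE ->.
Qed.

Lemma empirical_ge0 n (y : obs Y M n) i a : 0 <= empirical R y i a.
Proof. by rewrite divr_ge0. Qed.

Lemma empirical_dist n (y : obs Y M n) i : (0 < n)%N -> is_dist (empirical R y i).
Proof.
move=> n0; split; first by move=> a; apply: empirical_ge0.
rewrite -mulr_suml -natr_sum.
suff -> : (\sum_(a : Y) #|[pred k : 'I_n | y (k, i) == a]| = n)%N.
  by rewrite divff// pnatr_eq0 -lt0n.
transitivity (\sum_(a : Y) \sum_(k < n | y (k, i) == a) 1)%N.
  by apply: eq_bigr => a _; rewrite sum1_card.
rewrite -[RHS]card_ord -sum1_card.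
by rewrite [RHS](partition_big (fun k : 'I_n => y (k, i)) predT).
Qed.

Lemma avg_empirical_ge0 n (y : obs Y M n) S a : 0 <= avg_empirical R y S a.
Proof.
by rewrite mulr_ge0// ?invr_ge0//; apply: sumr_ge0 => i _; apply: empirical_ge0.
Qed.

Lemma setN0_card (S : {set 'I_M}) : S != finset.set0 -> #|S|%:R != 0 :> R.
Proof. by rewrite pnatr_eq0 cards_eq0. Qed.

Lemma avg_empiricalM n (y : obs Y M n) S a : S != finset.set0 ->
  #|S|%:R * avg_empirical R y S a = \sum_(i in S) empirical R y i a.
Proof. by move=> S0; rewrite mulrA divff ?mul1r ?setN0_card. Qed.

Lemma avg_empirical_eq0 n (y : obs Y M n) S i a : i \in S ->
  avg_empirical R y S a = 0 -> empirical R y i a = 0.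
Proof.
move=> iS /eqP; rewrite mulf_eq0 invr_eq0.
have S0 : S != finset.set0 by apply/set0Pn; exists i.
rewrite (negbTE (setN0_card S0))/= psumr_eq0; last by move=> *; apply: empirical_ge0.
by move=> /allP/(_ i (mem_index_enum _)); rewrite iS => /eqP.
Qed.

Lemma avg_empirical_dist n (y : obs Y M n) S : (0 < n)%N -> S != finset.set0 ->
  is_dist (avg_empirical R y S).
Proof.
move=> n0 S0; split; first by move=> a; apply: avg_empirical_ge0.
rewrite -mulr_sumr exchange_big/=.
rewrite (eq_bigr (fun=> 1)); last by move=> i _; case: (empirical_dist y i n0).
by rewrite sumr_const mulVf// setN0_card.
Qed.

(** The cost [glr_cost] as a real number; the two agree when [pi] has full
    support. *)
Definition glr pi n (y : obs Y M n) S : R :=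
  \sum_(i in S) klr (empirical R y i) (avg_empirical R y S)
  + \sum_(j in ~: S) klr (empirical R y j) pi.

Lemma glr_costE pi n (y : obs Y M n) S : full_support pi ->
  glr_cost pi y S = (glr pi y S)%:E.
Proof.
move=> fpi; rewrite /glr_cost /glr EFinD -!sumEFin; congr (_ + _)%E.
- apply: eq_bigr => i iS; apply: KL_klr => a.
  exact: avg_empirical_eq0.
- by apply: eq_bigr => j _; apply: KL_klr_full.
Qed.

(** The divergence of the empirical distributions from the laws under [S]. *)
Definition emp_div mu pi S n (y : obs Y M n) : R :=
  \sum_(i < M) klr (empirical R y i) (seq_law mu pi S i).

Lemma klr_empirical_avg_ge0 n (y : obs Y M n) S i : (0 < n)%N -> i \in S ->
  0 <= klr (empirical R y i) (avg_empirical R y S).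
Proof.
move=> n0 iS; have S0 : S != finset.set0 by apply/set0Pn; exists i.
rewrite -lee_fin -KL_klr => [|a]; last exact: avg_empirical_eq0.
apply: le_trans (KL_ge_hell (empirical_dist _ _ n0) (avg_empirical_dist _ n0 S0)).
by rewrite lee_fin hell_ge0.
Qed.

Lemma glr_ge0 pi n (y : obs Y M n) S : (0 < n)%N -> is_dist pi ->
  full_support pi -> 0 <= glr pi y S.
Proof.
move=> n0 dpi fpi; apply: addr_ge0; apply: sumr_ge0 => i iS.
  exact: klr_empirical_avg_ge0.
by apply: klr_ge0 => //; apply: empirical_dist.
Qed.

(** The average of the empirical distributions of [S] is the common law that
    fits them best. *)
Lemma glr_le_emp_div mu pi n (y : obs Y M n) S : (0 < n)%N ->
  is_dist mu -> full_support mu -> S != finset.set0 ->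
  glr pi y S <= emp_div mu pi S y.
Proof.
move=> n0 dmu fmu S0.
rewrite /emp_div (bigID [in S])/=; apply: lerD; last first.
  rewrite le_eqVlt; apply/orP; left; apply/eqP.
  apply: eq_big => [i|i]; first by rewrite finset.in_setC.
  by rewrite finset.in_setC /seq_law => /negbTE ->.
have -> : \sum_(i in S) klr (empirical R y i) (seq_law mu pi S i) =
    \sum_(i in S) klr (empirical R y i) mu.
  by apply: eq_bigr => i iS; rewrite /seq_law iS.
rewrite -subr_ge0 -sumrB.
suff -> : \sum_(i in S) (klr (empirical R y i) mu -
      klr (empirical R y i) (avg_empirical R y S)) =
    #|S|%:R * klr (avg_empirical R y S) mu.
  by rewrite mulr_ge0//; apply: klr_ge0 => //; apply: avg_empirical_dist.
rewrite mulr_sumr.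
transitivity (\sum_(i in S) \sum_(a : Y)
    empirical R y i a * ln (avg_empirical R y S a / mu a)).
  apply: eq_bigr => i iS; rewrite -sumrB; apply: eq_bigr => a _.
  have [->|e0] := eqVneq (empirical R y i a) 0; first by rewrite !mul0r subrr.
  have ep : 0 < empirical R y i a by rewrite lt_neqAle eq_sym e0 empirical_ge0.
  have ap : 0 < avg_empirical R y S a.
    rewrite lt_neqAle avg_empirical_ge0 andbT eq_sym; apply: contra_neq e0.
    exact: avg_empirical_eq0.
  by rewrite -mulrBr (lnB_divl ep (fmu a) ap).
rewrite exchange_big/=; apply: eq_bigr => a _.
by rewrite -mulr_suml -avg_empiricalM// mulrA.
Qed.

(** A singleton fits its own sequence perfectly. *)
Lemma glr_set1_le pi n (y : obs Y M n) (i : 'I_M) : (0 < n)%N ->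
  is_dist pi -> full_support pi ->
  glr pi y [set i]%SET <= \sum_(j < M) klr (empirical R y j) pi.
Proof.
move=> n0 dpi fpi.
have S0 : [set i]%SET != finset.set0 by apply/set0Pn; exists i; rewrite set11.
have := @glr_le_emp_div pi pi n y [set i]%SET n0 dpi fpi S0.
rewrite /emp_div (eq_bigr (fun j => klr (empirical R y j) pi))// /seq_law => j _.
by rewrite if_same.
Qed.

(** The law attributed in the limit to sequence [i] when the truth is [S] and
    [S'] is taken for the set of outliers: the sequences in [S'] share the
    average of their true laws, the others follow [pi]. *)
Definition best_law mu pi S S' (i : 'I_M) : Y -> R :=
  if i \in S' then mixture mu pi S S' else pi.

Lemma mixtureE mu pi S S' a :
  mixture mu pi S S' a = #|S'|%:R^-1 * \sum_(i in S') seq_law mu pi S i a.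
Proof.
rewrite /mixture [LHS]mulrC; congr (_ * _).
rewrite (big_setID S)/= finset.setIC; congr (_ + _).
- rewrite mulr_natl -sumr_const; apply: eq_bigr => i.
  by rewrite finset.in_setI => /andP[_ iS]; rewrite /seq_law iS.
- rewrite mulr_natl -sumr_const; apply: eq_bigr => i.
  by rewrite finset.in_setD => /andP[/negbTE iS _]; rewrite /seq_law iS.
Qed.

Lemma mixture_full mu pi S S' : full_support mu -> full_support pi ->
  S' != finset.set0 -> full_support (mixture mu pi S S').
Proof.
move=> fmu fpi S0 a; rewrite mixtureE mulr_gt0//.
  by rewrite invr_gt0 lt_neqAle eq_sym setN0_card//=.
have /set0Pn[i iS] := S0; rewrite (bigD1 i)//= ltr_pwDl//.
  exact: seq_law_full.
by apply: sumr_ge0 => j _; apply/ltW/seq_law_full.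
Qed.

Lemma mixture_dist mu pi S S' : is_dist mu -> is_dist pi ->
  S' != finset.set0 -> is_dist (mixture mu pi S S').
Proof.
move=> dmu dpi S0; split=> [a|].
  rewrite mixtureE mulr_ge0 ?invr_ge0//; apply: sumr_ge0 => i _.
  by case: (seq_law_dist S i dmu dpi).
rewrite (eq_bigr _ (fun a _ => mixtureE mu pi S S' a)) -mulr_sumr exchange_big/=.
rewrite (eq_bigr (fun=> 1)); last first.
  by move=> i _; case: (seq_law_dist S i dmu dpi).
by rewrite sumr_const mulVf// setN0_card.
Qed.

(** The limit of [glr] at [S'] when the truth is [S]. *)
Definition limit_cost mu pi S S' : R :=
  \sum_(i < M) klr (seq_law mu pi S i) (best_law mu pi S S' i).

(** The expression minimized in [alpha_S]. *)
Lemma limit_costE mu pi S S' : full_support mu -> full_support pi ->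
  S' != finset.set0 ->
  (#|S :&: S'|%:R%:E * KL mu (mixture mu pi S S')
      + #|S :\: S'|%:R%:E * KL mu pi
      + #|S' :\: S|%:R%:E * KL pi (mixture mu pi S S'))%E
  = (limit_cost mu pi S S')%:E.
Proof.
move=> fmu fpi S0; have fmix := mixture_full S fmu fpi S0.
rewrite !KL_klr_full// -!EFinM -!EFinD; congr _%:E.
rewrite /limit_cost (bigID [in S])/= [X in _ = X + _](bigID [in S'])/=.
rewrite [X in _ = _ + X](bigID [in S'])/=.
have sub_const (A : {set 'I_M}) (Q : pred 'I_M) F v : (forall i, Q i = (i \in A)) ->
    (forall i, i \in A -> F i = v) -> \sum_(i | Q i) F i = #|A|%:R * v :> R.
  move=> QA Fv; rewrite mulr_natl -sumr_const.
  by apply: eq_big => [//|i]; rewrite QA; exact: Fv.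
rewrite (sub_const (S :&: S') _ _ (klr mu (mixture mu pi S S'))) //; first last.
- by move=> i; rewrite inE => /andP[iS iS']; rewrite /seq_law /best_law iS iS'.
- by move=> i; rewrite !inE.
rewrite (sub_const (S :\: S') _ _ (klr mu pi)) //; first last.
- by move=> i; rewrite inE => /andP[/negbTE iS' iS]; rewrite /seq_law /best_law iS iS'.
- by move=> i; rewrite !inE andbC.
rewrite (sub_const (S' :\: S) _ _ (klr pi (mixture mu pi S S'))) //; first last.
- by move=> i; rewrite inE => /andP[/negbTE iS iS']; rewrite /seq_law /best_law iS iS'.
- by move=> i; rewrite !inE.
rewrite [X in _ = _ + (_ + X)]big1 ?addr0// => i /andP[/negbTE iS /negbTE iS'].
rewrite /seq_law /best_law iS iS' /klr big1// => a _.
by rewrite divff ?ln1 ?mulr0// gt_eqF.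
Qed.

(** A lower bound that is linear in the empirical distributions and exact at the
    true laws. *)
Lemma glr_ge_linear mu pi n (y : obs Y M n) S S' : (0 < n)%N ->
  is_dist mu -> is_dist pi -> full_support mu -> full_support pi ->
  S' != finset.set0 ->
  \sum_(i < M) \sum_(a : Y) empirical R y i a *
     ln (seq_law mu pi S i a / best_law mu pi S S' i a) <= glr pi y S'.
Proof.
move=> n0 dmu dpi fmu fpi S0.
have fl i a : 0 < seq_law mu pi S i a by apply: seq_law_full.
have fm := mixture_full S fmu fpi S0.
rewrite (bigID [in S'])/=; apply: lerD; last first.
  rewrite (eq_bigl [in ~: S']); last by move=> i; rewrite finset.in_setC.
  apply: ler_sum => j; rewrite finset.in_setC => /negbTE jS; rewrite /best_law jS.
  rewrite -subr_ge0 -sumrB.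
  rewrite -[leLHS](sum_sub_dist (empirical_dist y j n0) (seq_law_dist S j dmu dpi)).
  apply: ler_sum => a _.
  have [->|e0] := eqVneq (empirical R y j a) 0.
    by rewrite !mul0r subrr sub0r oppr_le0 ltW.
  have ep : 0 < empirical R y j a by rewrite lt_neqAle eq_sym e0 empirical_ge0.
  rewrite -mulrBr (lnB_divr ep (fl j a) (fpi a)).
  apply: mulr_ln_ge => //; [exact: ltW|exact: ltW|].
  by move=> e; have := fl j a; rewrite e ltxx.
rewrite -subr_ge0 -sumrB.
set g := avg_empirical R y S'; set m := mixture mu pi S S'.
have g0 a : 0 <= g a by apply: avg_empirical_ge0.
(* summed over [S'] and the alphabet, the weights [g * seq_law / m] and the
   empirical distributions both give [#|S'|] *)
have sum0 : \sum_(i in S') \sum_(a : Y)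
    (empirical R y i a - g a * (seq_law mu pi S i a / m a)) = 0.
  rewrite exchange_big/= (eq_bigr (fun=> 0)) ?big1// => a _.
  rewrite sumrB -mulr_sumr -mulr_suml -avg_empiricalM// -/g.
  have -> : \sum_(i in S') seq_law mu pi S i a = #|S'|%:R * m a.
    by rewrite /m mixtureE mulrA divff ?mul1r// setN0_card.
  by rewrite mulrK ?unitfE ?gt_eqF// mulrC subrr.
rewrite -[leLHS]sum0.
apply: ler_sum => i iS; rewrite -sumrB; apply: ler_sum => a _.
rewrite /best_law iS -/m.
have rp : 0 < seq_law mu pi S i a / m a by apply: divr_gt0.
have [->|e0] := eqVneq (empirical R y i a) 0.
  by rewrite !mul0r subrr sub0r oppr_le0 mulr_ge0// ltW.
have ep : 0 < empirical R y i a by rewrite lt_neqAle eq_sym e0 empirical_ge0.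
have gp : 0 < g a.
  rewrite lt_neqAle g0 andbT eq_sym; apply: contra_neq e0.
  exact: avg_empirical_eq0.
rewrite -mulrBr (lnB_mul ep gp rp).
apply: mulr_ln_ge => //; [exact: ltW|by rewrite mulr_ge0// ltW|].
by move=> e; have := mulr_gt0 gp rp; rewrite e ltxx.
Qed.

(** Near the true laws the cost of [S'] is not much below its limit. *)
Lemma glr_ge_limit mu pi S S' (e : R) :
  is_dist mu -> is_dist pi -> full_support mu -> full_support pi ->
  S' != finset.set0 -> 0 < e ->
  exists2 dl : R, 0 < dl & forall n (y : obs Y M n), (0 < n)%N ->
    emp_div mu pi S y <= dl -> limit_cost mu pi S S' - e <= glr pi y S'.
Proof.
move=> dmu dpi fmu fpi S0 e0.
pose L i a := ln (seq_law mu pi S i a / best_law mu pi S S' i a).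
pose B := 1 + \sum_(i < M) \sum_(a : Y) `|L i a|.
have B0 : 0 < B.
  by rewrite ltr_pwDl//; apply: sumr_ge0 => i _; apply: sumr_ge0.
exists ((e / (2 * B)) ^+ 2).
  by rewrite exprn_gt0// divr_gt0// mulr_gt0.
move=> n y n0 Dy; apply: le_trans (glr_ge_linear _ S n0 dmu dpi fmu fpi S0).
rewrite lerBlDr -lerBlDl /limit_cost -sumrB.
have close i a : `|seq_law mu pi S i a - empirical R y i a| <= e / B.
  rewrite distrC.
  have dl := seq_law_dist S i dmu dpi; have fl := seq_law_full S i fmu fpi.
  apply: le_trans (dist_close_hell a (empirical_dist y i n0) dl) _.
  have -> : e / B = 2 * (e / (2 * B)) by field; rewrite gt_eqF.
  have r0 : 0 <= e / (2 * B) by rewrite divr_ge0 ?mulr_ge0 ?ltW.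
  rewrite ler_pM2l// -(ger0_norm r0) -sqrtr_sqr ler_wsqrtr//.
  apply: le_trans (klr_ge_hell (empirical_dist y i n0) dl fl) _.
  apply: le_trans Dy; rewrite /emp_div (bigD1 i)//= lerDl.
  apply: sumr_ge0 => j _; apply: klr_ge0; first exact: empirical_dist.
    exact: seq_law_dist.
  exact: seq_law_full.
apply: (@le_trans _ _ (\sum_(i < M) \sum_(a : Y) e / B * `|L i a|)).
  apply: ler_sum => i _; rewrite /klr -sumrB; apply: ler_sum => a _.
  rewrite -/(L i a) -mulrBl; apply: le_trans (ler_norm _) _.
  by rewrite normrM ler_wpM2r.
under eq_bigr do rewrite -mulr_sumr.
rewrite -mulr_sumr -mulrA -[leRHS]mulr1 ler_pM2l// mulrC ler_pdivrMr// mul1r.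
by rewrite /B lerDr.
Qed.

End Costs.

(** * The method of types *)

Section Types.
Variables (R : realType) (Y : finType) (M : nat).
Implicit Types (mu pi : Y -> R) (S : {set 'I_M}).

Lemma sum_empirical n (y : obs Y M n) i (g : Y -> R) : (0 < n)%N ->
  n%:R * (\sum_(a : Y) empirical R y i a * g a) = \sum_(k < n) g (y (k, i)).
Proof.
move=> n0; rewrite mulr_sumr.
rewrite [RHS](partition_big (fun k : 'I_n => y (k, i)) predT)//=.
apply: eq_bigr => a _.
have nN0 : n%:R != 0 :> R by rewrite pnatr_eq0 -lt0n.
rewrite mulrA (_ : n%:R * empirical R y i a = #|[pred k : 'I_n | y (k, i) == a]|%:R).
  rewrite mulr_natl -sumr_const; apply: eq_bigr => k /eqP.
  by move=> ->.
by rewrite /empirical mulrC divfK.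
Qed.

Lemma empirical_gt0 n (y : obs Y M n) k i : 0 < empirical R y i (y (k, i)).
Proof.
have n0 : (0 < n)%N by case: k => [m]; case: n y.
rewrite divr_gt0// ltr0n//; apply/card_gt0P; exists k.
by rewrite inE.
Qed.

(** The probability of [y] is that of [y] under its own empirical distributions,
    times an exponential factor that depends only on the latter. *)
Lemma joint_law_emp_div mu pi S n (y : obs Y M n) : (0 < n)%N ->
  full_support mu -> full_support pi ->
  joint_law mu pi S y = expR (- (n%:R * emp_div mu pi S y)) *
    \prod_(k < n) \prod_(i < M) empirical R y i (y (k, i)).
Proof.
move=> n0 fmu fpi.
rewrite joint_lawE /emp_div mulr_sumr -sumrN.
rewrite (eq_bigr _ (fun i _ => congr1 _ (sum_empirical y i _ n0))).
under [X in expR X]eq_bigr do rewrite -sumrN.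
rewrite [X in expR X]exchange_big/= expR_sum -big_split; apply: eq_bigr => k _ /=.
rewrite expR_sum -big_split; apply: eq_bigr => i _ /=.
have ep := empirical_gt0 y k i; have lp := seq_law_full S i fmu fpi (y (k, i)).
rewrite expRN lnK ?posrE; last by apply: divr_gt0.
by rewrite invf_div divfK// gt_eqF.
Qed.

Lemma sum_prod_obs n (q : 'I_M -> Y -> R) :
  \sum_(y : obs Y M n) \prod_(k < n) \prod_(i < M) q i (y (k, i))
  = \prod_(k < n) \prod_(i < M) \sum_(a : Y) q i a.
Proof.
rewrite pair_bigA/= (bigA_distr_bigA (fun (ki : 'I_n * 'I_M) a => q ki.2 a)).
by apply: eq_bigr => y _; rewrite pair_bigA/=; apply: eq_bigr => -[k i].
Qed.

Lemma sum_prod_obs_dist n (q : 'I_M -> Y -> R) : (forall i, is_dist (q i)) ->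
  \sum_(y : obs Y M n) \prod_(k < n) \prod_(i < M) q i (y (k, i)) = 1.
Proof.
move=> dq; rewrite sum_prod_obs big1// => k _; rewrite big1// => i _.
by case: (dq i).
Qed.

(** The type of [y]: how many times each sequence takes each value. *)
Definition obs_type n (y : obs Y M n) : {ffun 'I_M * Y -> 'I_n.+1} :=
  [ffun ia => inord #|[pred k : 'I_n | y (k, ia.1) == ia.2]|].

Lemma empirical_obs_type n (y : obs Y M n) i a :
  empirical R y i a = (obs_type y (i, a))%:R / n%:R.
Proof.
rewrite ffunE /= inordK//= ltnS; apply: leq_trans (max_card _) _.
by rewrite card_ord.
Qed.

(** There are polynomially many types, and each one carries mass at most one. *)
Lemma sum_prod_empirical n : (0 < n)%N ->
  \sum_(y : obs Y M n) \prod_(k < n) \prod_(i < M) empirical R y i (y (k, i))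
  <= n.+1%:R ^+ (M * #|Y|).
Proof.
move=> n0; rewrite (partition_big (@obs_type n) predT)//=.
have -> : n.+1%:R ^+ (M * #|Y|) = \sum_(t : {ffun 'I_M * Y -> 'I_n.+1}) 1 :> R.
  by rewrite sumr_const card_ffun card_prod !card_ord natrX.
apply: ler_sum => t _.
case: (pickP (fun y : obs Y M n => obs_type y == t)) => [y0 /eqP ty0|none]; last first.
  by rewrite big_pred0.
rewrite -[leRHS](@sum_prod_obs_dist n (empirical R y0)); last first.
  by move=> i; apply: empirical_dist.
rewrite [leRHS](bigID (fun y : obs Y M n => obs_type y == t))/=.
rewrite (eq_bigr (fun y : obs Y M n =>
    \prod_(k < n) \prod_(i < M) empirical R y0 i (y (k, i)))).
  rewrite lerDl; apply: sumr_ge0 => y _; apply: prodr_ge0 => k _.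
  by apply: prodr_ge0 => i _; apply: empirical_ge0.
move=> y /eqP ty; apply: eq_bigr => k _; apply: eq_bigr => i _.
by rewrite !empirical_obs_type ty ty0.
Qed.

Lemma sum_joint_law_emp_div mu pi S n (l : R) : (0 < n)%N ->
  full_support mu -> full_support pi ->
  \sum_(y : obs Y M n | l < n%:R * emp_div mu pi S y) joint_law mu pi S y
  <= expR (- l) * n.+1%:R ^+ (M * #|Y|).
Proof.
move=> n0 fmu fpi.
have Q0 (y : obs Y M n) :
    0 <= \prod_(k < n) \prod_(i < M) empirical R y i (y (k, i)).
  by apply: prodr_ge0 => k _; apply: prodr_ge0 => i _; apply: empirical_ge0.
apply: (@le_trans _ _ (\sum_(y : obs Y M n | l < n%:R * emp_div mu pi S y)
    expR (- l) * \prod_(k < n) \prod_(i < M) empirical R y i (y (k, i)))).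
  apply: ler_sum => y ly; rewrite joint_law_emp_div//.
  by rewrite ler_wpM2r// ler_expR lerN2 ltW.
rewrite -mulr_sumr ler_pM2l ?expR_gt0//.
apply: le_trans (sum_prod_empirical n0).
rewrite [leRHS](bigID (fun y : obs Y M n => l < n%:R * emp_div mu pi S y))/=.
by rewrite lerDl sumr_ge0.
Qed.

Lemma joint_law_gt0 mu pi S n (y : obs Y M n) :
  full_support mu -> full_support pi -> 0 < joint_law mu pi S y.
Proof.
move=> fmu fpi; rewrite joint_lawE; apply: prodr_gt0 => k _.
by apply: prodr_gt0 => i _; apply: seq_law_full.
Qed.

End Types.

(** * The test as a function of finitely many observations *)

Section FiniteHorizon.
Variables (R : realType) (Y : finType) (M K : nat).
Variables (pi : Y -> R) (shat : estimator Y M) (f : R -> R) (T : R).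
Implicit Types x : obs_path Y M.

Lemma first_obs_le m n x x' : (n <= m)%N -> first_obs m x = first_obs m x' ->
  first_obs n x = first_obs n x'.
Proof.
move=> nm /ffunP e; apply/ffunP => -[k i]; have := e (widen_ord nm k, i).
by rewrite !ffunE.
Qed.

(** The continuation of a finite array of observations by the constant [a]. *)
Definition obs_extend (a : Y) m (y : obs Y M m) : obs_path Y M :=
  fun k i => if insub k is Some k' then y (k', i) else a.

Lemma first_obs_extend a m (y : obs Y M m) : first_obs m (obs_extend a y) = y.
Proof. by apply/ffunP => -[k i]; rewrite ffunE /obs_extend /= valK. Qed.

(** The stopping condition, without [0 < n], after [n] observations of the path
    [x]. *)
Definition stops_at x n := stops K pi shat T (first_obs n x).

(** The two ways in which the test can end on the path [x], with its sample size
    and decision. *)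
Variant test_spec x : nat -> {set 'I_M} -> Prop :=
| TestStops n of (0 < n <= Num.truncn (f T))%N & stops_at x n
    & (forall k, (0 < k < n)%N -> ~~ stops_at x k) :
    test_spec x n (shat (first_obs n x))
| TestTimeout of (forall k, (0 < k <= Num.truncn (f T))%N -> ~~ stops_at x k) :
    test_spec x (Num.truncn (f T)) finset.set0.

Lemma testP x : test_spec x (Nstar K pi shat f T x) (dstar K pi shat f T x).
Proof.
rewrite /dstar /Nstar /Ntilde /first_time; case: pselect => [h|none]; last first.
  apply: TestTimeout => k /andP[k0 _]; apply/negP => sk; apply: none.
  by exists k; rewrite k0.
case: ex_minnP => n /andP[n0 sn] nmin.
have small : (n%:R <= f T) = (n <= Num.truncn (f T))%N.
  by case: n n0 {sn nmin} => // n _; rewrite truncn_gt_nat.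
rewrite small; case: leqP => nm.
- apply: TestStops; rewrite ?n0//.
  move=> k /andP[k0 kn]; apply/negP => sk.
  by have := nmin k (introT andP (conj k0 sk)); rewrite leqNgt kn.
- apply: TestTimeout => k /andP[k0 km].
  apply/negP => sk; have := nmin k (introT andP (conj k0 sk)).
  by rewrite leqNgt (leq_ltn_trans km nm).
Qed.

Lemma test_unique x x' N N' D D' :
  first_obs (Num.truncn (f T)) x = first_obs (Num.truncn (f T)) x' ->
  test_spec x N D -> test_spec x' N' D' -> N = N' /\ D = D'.
Proof.
move=> e.
have es n : (n <= Num.truncn (f T))%N -> stops_at x n = stops_at x' n.
  by move=> nm; rewrite /stops_at (first_obs_le nm e).
move=> [n /andP[n0 nm] sn nmin|tout] [n' /andP[n0' nm'] sn' nmin'|tout'] //.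
- have nn' : n = n'.
    apply/eqP; rewrite eqn_leq; apply/andP; split; rewrite leqNgt; apply/negP => lt.
      by have := nmin n'; rewrite n0' lt es// sn' => /(_ isT).
    by have := nmin' n; rewrite n0 lt -es// sn => /(_ isT).
  by subst n'; rewrite (first_obs_le nm e).
- by have := tout' n; rewrite n0 nm -es// sn => /(_ isT).
- by have := tout n'; rewrite n0' nm' es// sn' => /(_ isT).
Qed.

(** The test is a function of the first [floor (f T)] observations. *)
Lemma test_finite_horizon a x :
  let x' := obs_extend a (first_obs (Num.truncn (f T)) x) in
  Nstar K pi shat f T x = Nstar K pi shat f T x' /\
  dstar K pi shat f T x = dstar K pi shat f T x'.
Proof.
by apply: test_unique (testP _) (testP _); rewrite first_obs_extend.
Qed.

End FiniteHorizon.

Section ObservableEvents.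
Variables (R : realType) (Y : finType) (M K : nat) (mu pi : Y -> R).
Variables (d : measure_display) (Omega : measurableType d).
Variables (P : {set 'I_M} -> probability Omega R) (X : Omega -> obs_path Y M).
Hypothesis model : outlier_model K mu pi P X.

Lemma obs_event_bigcup n (A : pred (obs Y M n)) :
  [set w | A (first_obs n (X w))] =
  \bigcup_(y in [set` A]) [set w | first_obs n (X w) = y].
Proof.
apply/seteqP; split => w /=; first by move=> Aw; exists (first_obs n (X w)).
by move=> [y Ay /= ->].
Qed.

Lemma measurable_obs_event n (A : pred (obs Y M n)) :
  measurable [set w | A (first_obs n (X w))].
Proof.
rewrite obs_event_bigcup bigcup_pred; apply: bigsetU_measurable => y _.
exact: (proj1 model).
Qed.

Lemma prob_obs_event n (A : pred (obs Y M n)) S : hyps K S ->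
  P S [set w | A (first_obs n (X w))] =
  (\sum_(y : obs Y M n | A y) joint_law mu pi S y)%:E.
Proof.
move=> hS; rewrite obs_event_bigcup measure_fin_bigcup//; first last.
- by move=> y _; exact: (proj1 model).
- by move=> y z _ _ [w [/= -> ->]].
rewrite -sumEFin [RHS]bigfs ?index_enum_uniq//; last first.
  by move=> y _; rewrite mem_index_enum.
by apply: eq_fsbigr => y _; exact: (proj2 model).
Qed.

Lemma measurable_obs_fun n (h : obs Y M n -> R) :
  measurable_fun setT (fun w => h (first_obs n (X w))).
Proof.
move=> _ B mB; rewrite setTI.
have -> : (fun w => h (first_obs n (X w))) @^-1` B =
    [set w | (fun y => `[< B (h y) >]) (first_obs n (X w))].
  by apply/seteqP; split => w /=; rewrite asboolE.
exact: (measurable_obs_event (fun y => `[< B (h y) >])).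
Qed.

Lemma prob_emp_div_gt n S (l : R) : (0 < n)%N -> hyps K S ->
  full_support mu -> full_support pi ->
  (P S [set w | (l < n%:R * emp_div mu pi S (first_obs n (X w)))%R]
   <= (expR (- l) * n.+1%:R ^+ (M * #|Y|))%:E)%E.
Proof.
move=> n0 hS fmu fpi.
rewrite (prob_obs_event (fun y => l < n%:R * emp_div mu pi S y) hS) lee_fin.
exact: sum_joint_law_emp_div.
Qed.

End ObservableEvents.

(** * When the test stops *)

Section Estimates.
Variable R : realType.

Lemma ln_le_linear (A e : R) : 0 <= A -> 0 < e ->
  exists2 C : R, 0 <= C & forall x, 0 < x -> A * ln x <= e * x + C.
Proof.
move=> A0 e0; pose k := e / (A + 1).
have k0 : 0 < k by rewrite divr_gt0// ltr_wpDl.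
exists `|A * ln k| => // x x0.
have -> : ln x = ln (k * x) - ln k by rewrite lnM ?posrE//; ring.
have lnk : ln (k * x) <= k * x.
  have := @le_ln1Dx R (k * x - 1); rewrite (addrC 1) subrK.
  rewrite ltrBrDr addNr mulr_gt0// => /(_ isT) h.
  by apply: le_trans h _; rewrite gerBl.
have Ak : A * (k * x) <= e * x.
  rewrite mulrA ler_pM2r// /k mulrA ler_pdivrMr ?ltr_wpDl// mulrC.
  by rewrite ler_pM2l// lerDl.
rewrite mulrBr; apply: lerD; last by rewrite -normrN ler_norm.
by apply: le_trans Ak; rewrite ler_wpM2l.
Qed.

Lemma exp_decay_poly (e : R) (B : nat) : 0 < e ->
  exists2 C : R, 0 < C &
    forall n, expR (- (n%:R * e)) * n.+1%:R ^+ B <= C * n.+1%:R ^- 2.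
Proof.
move=> e0; have [C C0 hC] := ln_le_linear (ler0n R (B + 2)) e0.
exists (expR (e + C)); first exact: expR_gt0.
move=> n; have n0 : 0 < n.+1%:R :> R by [].
rewrite ler_pdivlMr ?exprn_gt0// -mulrA -exprD.
rewrite -{1}(lnK (n0 : n.+1%:R \is Num.pos)) -expRM_natl -expRD ler_expR.
by have := hC _ n0; rewrite -natr1 mulrDr mulr1; lra.
Qed.

Lemma sum_inv_sqr m : \sum_(j < m) j.+2%:R ^- 2 <= 1 :> R.
Proof.
suff : \sum_(j < m) j.+2%:R ^- 2 <= 1 - m.+1%:R^-1 :> R.
  by move=> h; apply: le_trans h _; rewrite gerBl invr_ge0.
elim: m => [|m IH]; first by rewrite big_ord0 invr1 subrr.
rewrite big_ord_recr/=; apply: le_trans (lerD IH (lexx _)) _.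
rewrite -addrA lerD2l.
have a0 : 0 < m.+1%:R :> R by [].
have -> : m.+2%:R = m.+1%:R + 1 :> R by rewrite natr1.
move: (m.+1%:R : R) a0 => a a0.
rewrite -subr_ge0.
have -> : - (a + 1)^-1 - (- a^-1 + (a + 1) ^- 2) = (a * (a + 1) ^+ 2)^-1.
  by field; rewrite !gt_eqF// addr_gt0.
by rewrite invr_ge0 mulr_ge0 ?exprn_ge0 ?addr_ge0// ltW.
Qed.

Lemma sum_inv_sqr1 m : \sum_(j < m) j.+1%:R ^- 2 <= 2 :> R.
Proof.
case: m => [|m]; first by rewrite big_ord0.
rewrite big_ord_recl/= expr1n invr1 (_ : 2 = 1 + 1)// lerD2l.
exact: sum_inv_sqr.
Qed.

End Estimates.

Section Stopping.
Variables (R : realType) (Y : finType) (M K : nat) (mu pi : Y -> R).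
Hypotheses (dmu : is_dist mu) (dpi : is_dist pi).
Hypotheses (fmu : full_support mu) (fpi : full_support pi).
Implicit Types (S : {set 'I_M}) (shat : estimator Y M) (T : R).

Lemma stopsP shat T n (y : obs Y M n) :
  reflect (forall S', nonnull K S' -> S' != shat n y ->
      threshold Y M T n < n%:R * (glr pi y S' - glr pi y (shat n y)))
    (stops K pi shat T y).
Proof.
apply: (iffP (bigmin_gtP _ _ _ _)) => [[_ h] S' nS' S'y | h].
  have := h S'; rewrite nS' S'y !glr_costE// => /(_ isT).
  by rewrite -EFinB -EFinM lte_fin.
split; first by rewrite ltry.
move=> S' /andP[nS' S'y]; rewrite !glr_costE// -EFinB -EFinM lte_fin.
exact: h.
Qed.

Lemma argmin_glr shat n (y : obs Y M n) : (0 < n)%N ->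
  argmin_estimator K pi shat ->
  nonnull K (shat n y) /\
  forall S, nonnull K S -> glr pi y (shat n y) <= glr pi y S.
Proof.
move=> n0 /(_ n y n0)[nn h]; split=> // S /h.
by rewrite !glr_costE// lee_fin.
Qed.

Lemma nonnull_set1 (i : 'I_M) : (0 < K)%N -> nonnull K [set i]%SET.
Proof.
by move=> K0; rewrite /nonnull /hyps cards1 K0 -finset.card_gt0 cards1.
Qed.

(** Stopping with a wrong estimate requires the empirical distributions to be
    far from the true laws: under the null hypothesis, some singleton is a
    competitor whose cost is dominated by the divergence. *)
Lemma wrong_stop_emp_div shat T n (y : obs Y M n) S : (0 < n)%N ->
  (1 < M)%N -> (0 < K)%N -> argmin_estimator K pi shat -> hyps K S ->
  stops K pi shat T y -> shat n y != S ->
  threshold Y M T n < n%:R * emp_div mu pi S y.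
Proof.
move=> n0 M1 K0 hshat hS /stopsP st yS.
have [nn _] := argmin_glr y n0 hshat.
suff [S' [nS' S'y le]] : exists S', [/\ nonnull K S', S' != shat n y &
    glr pi y S' <= emp_div mu pi S y].
  apply: lt_le_trans (st S' nS' S'y) _; rewrite ler_wpM2l//.
  by apply: le_trans le; rewrite gerBl glr_ge0.
have [S0|SN0] := eqVneq S finset.set0; last first.
  exists S; rewrite /nonnull hS SN0; split=> //; first by rewrite eq_sym.
  exact: glr_le_emp_div.
have sing (i : 'I_M) : nonnull K [set i]%SET by exact: nonnull_set1.
have le i : glr pi y [set i]%SET <= emp_div mu pi S y.
  apply: le_trans (glr_set1_le _ _ n0 dpi fpi) _.
  by apply: ler_sum => j _; rewrite /seq_law S0 finset.in_set0.
pose i0 := Ordinal (ltnW M1); pose i1 := Ordinal M1.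
have [e|ne] := eqVneq [set i0]%SET (shat n y); last by exists [set i0]%SET.
exists [set i1]%SET; split=> //; rewrite -e.
by apply/eqP => /setP/(_ i1); rewrite !inE eqxx.
Qed.

(** When the empirical distributions are close to the true laws, the stopping
    condition holds as soon as [n] exceeds [ln T / b] by a constant. *)
Lemma stops_near_laws S (a b : R) : nonnull K S -> 0 < b < a ->
  (forall S', nonnull K S' -> S' != S -> a <= limit_cost mu pi S S') ->
  exists C dl : R, [/\ 0 <= C, 0 < dl & forall shat T n (y : obs Y M n),
    argmin_estimator K pi shat -> (0 < n)%N -> emp_div mu pi S y <= dl ->
    ln T + C < n%:R * b -> stops K pi shat T y].
Proof.
move=> nS /andP[b0 ba] ha; have /andP[_ SN0] := nS.
pose e := (a - b) / 4.
have e0 : 0 < e by rewrite divr_gt0// subr_gt0.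
have /choice[D hD] : forall S', exists dl : R, 0 < dl /\
    (S' != finset.set0 -> forall n (y : obs Y M n), (0 < n)%N ->
      emp_div mu pi S y <= dl -> limit_cost mu pi S S' - e <= glr pi y S').
  move=> S'; have [S0|SN] := eqVneq S' finset.set0; first by exists 1.
  have [dl dl0 h] := glr_ge_limit S dmu dpi fmu fpi SN e0.
  by exists dl.
have [C C0 hC] := @ln_le_linear R (M.+1%:R * #|Y|%:R) (2 * e)
  (mulr_ge0 (ler0n _ _) (ler0n _ _)) (mulr_gt0 (ltr0n _ 2) e0).
exists (2 * e + C), (\big[Order.min/e]_S' D S'); split.
- by rewrite addr_ge0// mulr_ge0// ltW.
- by apply: lt_bigmin => // S' _; case: (hD S').
move=> shat T n y hshat n0 Dy lt.
have glrS : glr pi y S <= e.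
  apply: le_trans (glr_le_emp_div pi y n0 dmu fmu SN0) _.
  by apply: le_trans Dy _; apply: bigmin_le_id.
have glrS' S' : nonnull K S' -> S' != S -> a - e <= glr pi y S'.
  move=> nS' S'S; have /andP[_ S'0] := nS'.
  have [_ /(_ S'0 n y n0) h] := hD S'.
  apply: le_trans (h _); first by rewrite lerD2r; exact: ha.
  by apply: le_trans Dy _; apply: bigmin_le.
have [nn min] := argmin_glr y n0 hshat.
have eS : shat n y = S.
  apply/eqP; apply: contraT => ne; have := le_trans (glrS' _ nn ne) (min _ nS).
  by move: glrS ba b0; rewrite /e; lra.
apply/stopsP => S' nS'; rewrite eS => S'S.
have gap : b + 2 * e <= glr pi y S' - glr pi y S.
  by have := glrS' S' nS' S'S; move: glrS; rewrite /e; lra.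
apply: lt_le_trans (_ : n%:R * (b + 2 * e) <= _); last by rewrite ler_wpM2l.
rewrite /threshold mulrDr.
by have := hC n.+1%:R (ltr0n _ _); rewrite -{2}natr1; lra.
Qed.

End Stopping.

(** * Exponents *)

Section Exponents.
Variables (R : realType) (Y : finType) (M K : nat) (mu pi : Y -> R).
Hypotheses (dmu : is_dist mu) (dpi : is_dist pi).
Hypotheses (fmu : full_support mu) (fpi : full_support pi).
Implicit Types S : {set 'I_M}.

Lemma KL_gt0 : mu <> pi -> (0 < KL mu pi)%E.
Proof.
move=> ne; apply: lt_le_trans (KL_ge_hell dmu dpi).
by rewrite lte_fin hell_gt0.
Qed.

Lemma eta_S_ge_hell S : S != finset.set0 -> ((hell mu pi / 2)%:E <= eta_S mu pi S)%E.
Proof.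
move=> S0; apply/ereal_infP => _ [p dp <-].
apply: (@le_trans _ _ ((hell mu p)%:E + (hell pi p)%:E)%E).
  rewrite -EFinD lee_fin ler_pdivrMr// mulrC.
  exact: hell_triangle.
apply: leeD; last exact: KL_ge_hell.
apply: le_trans (KL_ge_hell dmu dp) _.
rewrite lee_pemull ?lee_fin ?ler1n ?finset.card_gt0//.
by apply: le_trans (KL_ge_hell dmu dp); rewrite lee_fin hell_ge0.
Qed.

Lemma limit_costEr S S' : S' != finset.set0 ->
  limit_cost mu pi S S' = #|S :&: S'|%:R * klr mu (mixture mu pi S S')
      + #|S :\: S'|%:R * klr mu pi
      + #|S' :\: S|%:R * klr pi (mixture mu pi S S').
Proof.
move=> S0; apply: EFin_inj; rewrite -limit_costE//.
by have fm := mixture_full S fmu fpi S0; rewrite !KL_klr_full.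
Qed.

(** If some true outlier is missing from [S'], its term alone is at least the
    divergence of [mu] from [pi]. *)
Lemma limit_cost_ge_KL S S' : S' != finset.set0 -> ~~ (S \subset S') ->
  klr mu pi <= limit_cost mu pi S S'.
Proof.
move=> S0 SS'; rewrite limit_costEr//.
have fm := mixture_full S fmu fpi S0; have dm := mixture_dist S dmu dpi S0.
have h1 : 0 <= #|S :&: S'|%:R * klr mu (mixture mu pi S S').
  by rewrite mulr_ge0// klr_ge0.
have h3 : 0 <= #|S' :\: S|%:R * klr pi (mixture mu pi S S').
  by rewrite mulr_ge0// klr_ge0.
suff : klr mu pi <= #|S :\: S'|%:R * klr mu pi by lra.
rewrite ler_peMl ?klr_ge0// ler1n finset.card_gt0.
by rewrite finset.setD_eq0.
Qed.

(** If [S'] is a proper extension of [S], the mixture is a competitor in the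
    infimum that defines [eta_S]. *)
Lemma limit_cost_ge_eta S S' : S' != S -> S \subset S' -> S' != finset.set0 ->
  (eta_S mu pi S <= (limit_cost mu pi S S')%:E)%E.
Proof.
move=> ne SS' S0; rewrite limit_costEr//.
have fm := mixture_full S fmu fpi S0; have dm := mixture_dist S dmu dpi S0.
apply: ge_ereal_inf; exists (#|S|%:R%:E * KL mu (mixture mu pi S S') +
    KL pi (mixture mu pi S S'))%E; first by exists (mixture mu pi S S').
rewrite !KL_klr_full// -EFinM -EFinD lee_fin.
rewrite (finset.setIidPl SS').
have -> : #|S :\: S'| = 0%N.
  by apply/eqP; rewrite cards_eq0 finset.setD_eq0.
rewrite mul0r addr0 lerD2l ler_peMl ?klr_ge0// ler1n finset.card_gt0.
rewrite finset.setD_eq0; apply: contra ne => S'S.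
by rewrite finset.eqEsubset S'S.
Qed.

(** The exponent in the second bound on the expected sample size. *)
Definition rate_S S : \bar R :=
  if #|S| == K then KL mu pi else Order.min (KL mu pi) (eta_S mu pi S).

Lemma rate_S_le_KL S : (rate_S S <= KL mu pi)%E.
Proof. by rewrite /rate_S; case: ifP => // _; rewrite ge_min lexx. Qed.

Lemma rate_S_gt0 S : mu <> pi -> S != finset.set0 -> (0 < rate_S S)%E.
Proof.
move=> ne S0; rewrite /rate_S; case: ifP => _; first exact: KL_gt0.
rewrite lt_min KL_gt0//=; apply: lt_le_trans (eta_S_ge_hell S0).
by rewrite lte_fin divr_gt0// hell_gt0.
Qed.

Lemma rate_S_le_alpha S : nonnull K S -> (rate_S S <= alpha_S K mu pi S)%E.
Proof.
move=> /andP[hS S0]; apply/bigmin_geP; split; first by rewrite leey.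
move=> S' /andP[/andP[hS' S'0] ne]; rewrite limit_costE//.
have [SS'|SS'] := boolP (S \subset S'); last first.
  apply: le_trans (rate_S_le_KL S) _; rewrite KL_klr_full// lee_fin.
  exact: limit_cost_ge_KL.
rewrite /rate_S; case: eqP => [cS|_].
  (* a hypothesis of maximal size has no proper extension *)
  exfalso; move/negP: ne; apply; rewrite eq_sym finset.eqEcard SS' cS.
  exact: hS'.
by rewrite ge_min limit_cost_ge_eta// orbT.
Qed.

Lemma alpha_S_le_limit S S' : nonnull K S' -> S' != S ->
  (alpha_S K mu pi S <= (limit_cost mu pi S S')%:E)%E.
Proof.
move=> nS' ne; have /andP[_ S'0] := nS'; rewrite -limit_costE//.
by apply: bigmin_le_cond; rewrite nS' ne.
Qed.

(** [alpha_S] is finite because some non-null hypothesis differs from [S]. *)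
Lemma alpha_S_fin S : (1 < M)%N -> (0 < K)%N -> mu <> pi -> nonnull K S ->
  alpha_S K mu pi S \is a fin_num /\ (0 < alpha_S K mu pi S)%E.
Proof.
move=> M1 K0 ne nS; have /andP[_ S0] := nS.
have a0 := lt_le_trans (rate_S_gt0 ne S0) (rate_S_le_alpha nS).
split=> //; rewrite gt0_fin_numE//.
pose i0 := Ordinal (ltnW M1); pose i1 := Ordinal M1.
have [S' nS' S'S] : exists2 S', nonnull K S' & S' != S.
  have [<-|] := eqVneq [set i0]%SET S; last first.
    by exists [set i0]%SET; rewrite ?nonnull_set1.
  exists [set i1]%SET; rewrite ?nonnull_set1//.
  by apply/eqP => /setP/(_ i1); rewrite !inE eqxx.
by apply: le_lt_trans (alpha_S_le_limit nS' S'S) _; rewrite ltry.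
Qed.

Lemma rate_S_fin S : mu <> pi -> S != finset.set0 -> rate_S S \is a fin_num.
Proof.
move=> ne S0; rewrite gt0_fin_numE ?rate_S_gt0//.
by apply: le_lt_trans (rate_S_le_KL S) _; rewrite KL_klr_full// ltry.
Qed.

End Exponents.

(** * Error probability *)

Section ErrorProbability.
Variables (R : realType) (Y : finType) (M K : nat) (mu pi : Y -> R).
Hypotheses (dmu : is_dist mu) (dpi : is_dist pi).
Hypotheses (fmu : full_support mu) (fpi : full_support pi).
Hypotheses (mu_neq_pi : mu <> pi) (M1 : (1 < M)%N) (K0 : (0 < K)%N).
Implicit Types (S : {set 'I_M}) (T : R).

Section FixedModel.
Variables (d : measure_display) (Omega : measurableType d).
Variables (P : {set 'I_M} -> probability Omega R) (X : Omega -> obs_path Y M).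
Hypothesis model : outlier_model K mu pi P X.
Variables (f : R -> R) (shat : estimator Y M).
Hypothesis hshat : argmin_estimator K pi shat.

(** The term [ln n.+1] of the threshold absorbs the number of types and leaves a
    summable bound, since the alphabet has at least two letters. *)
Lemma prob_emp_div_threshold T n S : 0 < T -> (0 < n)%N -> hyps K S ->
  (P S [set w | (threshold Y M T n < n%:R * emp_div mu pi S (first_obs n (X w)))%R]
   <= (T^-1 * n.+1%:R ^- 2)%:E)%E.
Proof.
move=> T0 n0 hS; apply: le_trans (prob_emp_div_gt model _ n0 hS fmu fpi) _.
rewrite lee_fin /threshold.
have N0 : 0 < n.+1%:R :> R by [].
rewrite opprD expRD -{1}lnV// lnK ?posrE ?invr_gt0// -mulrA ler_pM2l ?invr_gt0//.
rewrite -natrM expRN mulrC expRM_natl lnK ?posrE// ler_pdivrMr ?exprn_gt0//.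
rewrite mulrC ler_pdivlMr ?exprn_gt0// -exprD ler_weXn2l ?ler1n//.
by rewrite mulSn addnC leq_add2r (dist_neq_card dmu dpi mu_neq_pi).
Qed.

Lemma measurable_dec T S : measurable [set w | dstar K pi shat f T (X w) != S].
Proof.
have [y _] : exists y : Y, True.
  by have /card_gt0P[y _] := ltnW (dist_neq_card dmu dpi mu_neq_pi); exists y.
have -> : [set w | dstar K pi shat f T (X w) != S] =
    [set w | (fun z => dstar K pi shat f T (obs_extend y z) != S)
       (first_obs (Num.truncn (f T)) (X w))].
  apply/seteqP; split => w /=;
    by have [_ <-] := test_finite_horizon K pi shat f T y (X w).
exact: (measurable_obs_event model
  (fun z => dstar K pi shat f T (obs_extend y z) != S)).
Qed.

(** An error is either a stop at a wrong estimate, or a missed deadline under a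
    non-null hypothesis. *)
Lemma prob_error_le T S : 0 < T -> hyps K S ->
  (P S [set w | dstar K pi shat f T (X w) != S] <= (T^-1)%:E +
   P S [set w | (fun y => (S != finset.set0) && ((Num.truncn (f T) == 0)%N ||
          ~~ stops K pi shat T y)) (first_obs (Num.truncn (f T)) (X w))])%E.
Proof.
move=> T0 hS; set m := Num.truncn (f T).
pose W n := [set w | threshold Y M T n < n%:R * emp_div mu pi S (first_obs n (X w))].
have mW n : measurable (W n).
  exact: (measurable_obs_event model
    (fun y => threshold Y M T n < n%:R * emp_div mu pi S y)).
pose A := [set w | dstar K pi shat f T (X w) != S].
pose late (y : obs Y M m) :=
  (S != finset.set0) && ((m == 0)%N || ~~ stops K pi shat T y).
pose B := [set w | late (first_obs m (X w))].
change (P S A <= (T^-1)%:E + P S B)%E.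
have mB : measurable B by exact: (measurable_obs_event model late).
have mU : measurable (\big[setU/set0]_(j < m) W j.+1).
  by apply: bigsetU_measurable => j _.
have AU : A `<=` (\big[setU/set0]_(j < m) W j.+1) `|` B.
  move=> w; rewrite /A /=.
  case: (testP K pi shat f T (X w)) => [n /andP[n0 nm] sn _ ne|tout ne].
  - left; rewrite -(bigcup_mkord m (fun j => W j.+1)); exists n.-1; rewrite /= prednK//.
    exact: wrong_stop_emp_div sn ne.
  - right; rewrite /B /late /= eq_sym ne /=; case: posnP => //= m0.
    by apply: tout; rewrite m0 leqnn.
apply: (@le_trans _ _ (P S ((\big[setU/set0]_(j < m) W j.+1) `|` B))).
  apply: le_measure => //; rewrite inE//; first exact: measurable_dec.
  exact: measurableU.
apply: le_trans (measureU2 _ mU mB) _; apply: leeD => //.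
apply: le_trans (Boole_inequality _ (A := fun j => W j.+1) _) _ => //.
apply: (@le_trans _ _ (\sum_(j < m) (T^-1 * j.+2%:R ^- 2)%:E)%E).
  by apply: lee_sum => j _; exact: prob_emp_div_threshold.
rewrite sumEFin lee_fin -mulr_sumr -[leRHS]mulr1 ler_pM2l ?invr_gt0//.
exact: sum_inv_sqr.
Qed.

(** Every decision is wrong under some hypothesis, and every finite array of
    observations has positive probability under it. *)
Lemma Pmax_gt0 T : 0 < Pmax K P X (dstar K pi shat f T).
Proof.
have [y _] : exists y : Y, True.
  by have /card_gt0P[y _] := ltnW (dist_neq_card dmu dpi mu_neq_pi); exists y.
pose m := Num.truncn (f T).
pose z : obs Y M m := [ffun=> y].
pose D := dstar K pi shat f T (obs_extend y z).
have [S hS SD] : exists2 S, hyps K S & D != S.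
  have [->|D0] := eqVneq D finset.set0; last first.
    by exists finset.set0; rewrite // /hyps cards0.
  have /andP[h1 h2] := @nonnull_set1 M K (Ordinal M1) K0.
  by exists [set Ordinal M1]%SET; rewrite // eq_sym.
pose err S' := fine (P S' [set w | dstar K pi shat f T (X w) != S']).
apply: (@lt_le_trans _ _ (err S)); last exact: (le_bigmax_cond _ err hS).
apply: (@lt_le_trans _ _ (fine (P S [set w | first_obs m (X w) = z]))).
  by rewrite (proj2 model)//= joint_law_gt0.
apply: fine_le; rewrite ?fin_num_measure//;
  try exact: measurable_dec; try exact: (proj1 model).
apply: le_measure; rewrite ?inE//; try exact: measurable_dec; try exact: (proj1 model).
move=> w /= e; have [_ ->] := test_finite_horizon K pi shat f T y (X w).
by rewrite -/m e.
Qed.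

End FixedModel.

Lemma prob_fine_le (d : measure_display) (Omega : measurableType d)
    (Q : probability Omega R) (A : set Omega) (b : R) : measurable A ->
  (Q A <= b%:E)%E -> fine (Q A) <= b.
Proof. by move=> mA h; rewrite -lee_fin fineK// fin_num_measure. Qed.

(** The probability that the empirical distributions are far from the true laws
    is summable. *)
Lemma prob_far_from_laws (dl : R) : 0 < dl -> exists2 C : R, 0 < C &
  forall (d : measure_display) (Omega : measurableType d)
    (P : {set 'I_M} -> probability Omega R) (X : Omega -> obs_path Y M),
  outlier_model K mu pi P X -> forall n S, (0 < n)%N -> hyps K S ->
  (P S [set w | (dl < emp_div mu pi S (first_obs n (X w)))%R]
    <= (C * n.+1%:R ^- 2)%:E)%E.
Proof.
move=> dl0; have [C C0 hC] := exp_decay_poly (M * #|Y|) dl0.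
exists C => // d Omega P X model n S n0 hS.
apply: (@le_trans _ _ (expR (- (n%:R * dl)) * n.+1%:R ^+ (M * #|Y|))%:E); last first.
  by rewrite lee_fin.
apply: le_trans (prob_emp_div_gt model _ n0 hS fmu fpi).
rewrite le_eqVlt; apply/orP; left; apply/eqP; congr (P S _).
by apply/seteqP; split => w /=; rewrite ltr_pM2l// ltr0n.
Qed.

(** [C] does not depend on [f], as long as [c] and [T0] are fixed: a larger [C]
    makes the bound trivial below some [T1], above which the deadline exceeds
    [T]. *)
Lemma prob_error_bound S (c T0 : R) : hyps K S -> 0 < c ->
  exists2 C : R, 0 < C &
  forall (f : R -> R) (shat : estimator Y M),
    grows_TlnT c T0 f -> argmin_estimator K pi shat ->
  forall (d : measure_display) (Omega : measurableType d)
    (P : {set 'I_M} -> probability Omega R) (X : Omega -> obs_path Y M),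
    outlier_model K mu pi P X ->
  forall T, 0 < T ->
    fine (P S [set w | dstar K pi shat f T (X w) != S]) <= C / T.
Proof.
move=> hS c0; have [S0|SN0] := eqVneq S finset.set0.
  exists 1 => // f shat gf hshat d Omega P X model T Tp.
  apply: prob_fine_le; first exact: (measurable_dec model).
  apply: le_trans (prob_error_le model f hshat Tp hS) _.
  rewrite S0 eqxx /= (_ : [set _ | false] = set0); last by apply/seteqP; split.
  by rewrite measure0 adde0 mul1r.
have nS : nonnull K S by rewrite /nonnull hS SN0.
have [afin a0] := alpha_S_fin dmu dpi fmu fpi M1 K0 mu_neq_pi nS.
set a := fine (alpha_S K mu pi S).
have aE : alpha_S K mu pi S = a%:E by rewrite fineK.
have ap : 0 < a by rewrite -lte_fin -aE.
pose b := a / 2.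
have b0 : 0 < b by rewrite divr_gt0.
have hb : 0 < b < a by rewrite b0 /b; lra.
have [|C1 [dl [C10 dl0 hst]]] := stops_near_laws dmu dpi fmu fpi nS hb.
  by move=> S' nS' ne; rewrite -lee_fin -aE alpha_S_le_limit.
have [C2 C20 hC2] := prob_far_from_laws dl0.
have b20 : 0 < b / 2 by rewrite divr_gt0.
have [C3 C30 hC3] := ln_le_linear (ler01 : 0 <= 1) b20.
(* from [T1] on, the deadline exceeds [T], and by then the test has stopped if the
   empirical distributions are close to the true laws *)
pose T1 := `|T0| + 1 + expR (2 / c) + 2 * (C1 + C3 + 1) / b.
have h1 : 0 <= 2 * (C1 + C3 + 1) / b by rewrite divr_ge0 ?(ltW b0)//; lra.
have h2 := expR_gt0 (2 / c).
have T1p : 0 < T1 by rewrite /T1; have := normr_ge0 T0; lra.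
exists (1 + C2 + T1); first lra.
move=> f shat gf hshat d Omega P X model T Tp.
apply: prob_fine_le; first exact: (measurable_dec model).
have [TT1|T1T] := ltP T T1.
  apply: le_trans (probability_le1 _ _) _; first exact: (measurable_dec model).
  by rewrite lee_fin ler_pdivlMr// mul1r; lra.
apply: le_trans (prob_error_le model f hshat Tp hS) _.
have Tge : `|T0| <= T /\ 1 <= T /\ expR (2 / c) <= T /\ 2 * (C1 + C3 + 1) / b <= T.
  by move: T1T; rewrite /T1; have := normr_ge0 T0; lra.
have [TT0 [T1' [Te Tb]]] := Tge.
have lnT : 2 / c <= ln T by rewrite -(expRK (2 / c)) ler_ln ?posrE.
have fT : T + 1 <= f T.
  apply: le_trans (gf T (le_trans (ler_norm _) TT0)).
  apply: (@le_trans _ _ (T * 2)); first lra.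
  rewrite mulrCA ler_pM2l//; move: lnT; rewrite ler_pdivrMr// mulrC.
  by [].
set m := Num.truncn (f T).
have Tm : T < m%:R by have := truncnS_gt (f T); rewrite -/m -natr1; lra.
have m0 : (0 < m)%N by rewrite -(ltr0n R); exact: lt_trans Tm.
have stopm : ln T + C1 < m%:R * b.
  apply: (@lt_trans _ _ (T * b)); last by rewrite ltr_pM2r.
  have := hC3 T Tp; move: Tb; rewrite ler_pdivrMr// mul1r; lra.
have : (P S [set w | (dl < emp_div mu pi S (first_obs m (X w)))%R] <= (C2 / T)%:E)%E.
  apply: le_trans (hC2 _ _ _ _ model m S m0 hS) _; rewrite lee_fin ler_pM2l//.
  rewrite lef_pV2 ?posrE ?exprn_gt0//; apply: le_trans (ltW Tm) _.
  by rewrite -natrX ler_nat (leq_trans (leqnSn m))// -{1}[m.+1]expn1 leq_exp2l.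
move=> far; apply: (@le_trans _ _ ((T^-1)%:E + (C2 / T)%:E)%E); last first.
  rewrite -EFinD lee_fin -{1}[T^-1]mul1r -mulrDl ler_pM2r ?invr_gt0//; lra.
apply: leeD => //; apply: le_trans far; apply: le_measure.
- rewrite inE; exact: (measurable_obs_event model (fun y => (S != finset.set0) &&
    ((m == 0)%N || ~~ stops K pi shat T y))).
- rewrite inE; exact: (measurable_obs_event model (fun y => dl < emp_div mu pi S y)).
move=> w /=; rewrite eqn0Ngt m0 /= => /andP[_]; apply: contraNT.
by rewrite -leNgt => Dw; exact: hst.
Qed.

End ErrorProbability.

(** * Expected sample size *)

Lemma sum_ltn_minn (R : realType) m n :
  \sum_(j < m) (j < n)%N%:R = (minn m n)%:R :> R.
Proof.
rewrite -natr_sum; congr _%:R; elim: m => [|m IH]; first by rewrite big_ord0 min0n.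
rewrite big_ord_recr/= IH; case: (ltnP m n) => mn.
- by rewrite (minn_idPl mn) addn1.
- by rewrite (minn_idPr (leqW mn)) addn0.
Qed.

Section SampleSize.
Variables (R : realType) (Y : finType) (M K : nat) (mu pi : Y -> R).
Hypotheses (dmu : is_dist mu) (dpi : is_dist pi).
Hypotheses (fmu : full_support mu) (fpi : full_support pi).
Hypotheses (mu_neq_pi : mu <> pi) (M1 : (1 < M)%N) (K0 : (0 < K)%N).
Implicit Types (S : {set 'I_M}) (T : R).

(** The test runs for about [ln T / b] steps, plus the steps at which the
    empirical distributions are far from the true laws; the expected number of
    the latter is bounded. *)
Lemma expected_size_bound S (b : R) : nonnull K S ->
  0 < b < fine (alpha_S K mu pi S) ->
  exists C : R,
  forall (f : R -> R) (shat : estimator Y M), argmin_estimator K pi shat ->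
  forall (d : measure_display) (Omega : measurableType d)
    (P : {set 'I_M} -> probability Omega R) (X : Omega -> obs_path Y M),
    outlier_model K mu pi P X ->
  forall T, 1 <= T ->
  ('E_(P S)[fun w => (Nstar K pi shat f T (X w))%:R] <= (ln T / b + C)%:E)%E.
Proof.
move=> nS hb; have /andP[hS _] := nS; have /andP[b0 _] := hb.
have [afin _] := alpha_S_fin dmu dpi fmu fpi M1 K0 mu_neq_pi nS.
have [|C1 [dl [C10 dl0 hst]]] := stops_near_laws dmu dpi fmu fpi nS hb.
  by move=> S' nS' ne; rewrite -lee_fin fineK// alpha_S_le_limit.
have [C2 C20 hC2] := prob_far_from_laws M K fmu fpi dl0.
exists (C1 / b + 1 + C2 * 2) => f shat hshat d Omega P X model T T1.
have [y0 _] : exists y : Y, True.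
  by have /card_gt0P[y _] := ltnW (dist_neq_card dmu dpi mu_neq_pi); exists y.
have lnT0 : 0 <= ln T by apply: ln_ge0.
pose q := (ln T + C1) / b; have q0 : 0 <= q by rewrite divr_ge0 ?addr_ge0// ltW.
pose n0 := (Num.truncn q).+1.
have n0le : n0%:R <= q + 1 by rewrite -natr1 lerD2r truncn_le.
have n0gt n : (n0 <= n)%N -> ln T + C1 < n%:R * b.
  move=> n0n; rewrite -ltr_pdivrMr//; apply: lt_le_trans (truncnS_gt q) _.
  by rewrite ler_nat.
set m := Num.truncn (f T).
(* the test is still running at time [j] only if [j] is small or the empirical
   distributions are far from the true laws *)
pose late n (y : obs Y M n) := (n < n0)%N || (dl < emp_div mu pi S y).
pose B j := [set w | late j (first_obs j (X w))].
have mB j : measurable (B j) by exact: (measurable_obs_event model (late j)).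
have Nle w : (Nstar K pi shat f T (X w))%:R <= \sum_(j < m) \1_(B j) w :> R.
  have running j : (j < Nstar K pi shat f T (X w))%N -> (j < m)%N /\
      ((0 < j)%N -> ~~ stops K pi shat T (first_obs j (X w))).
    case: (testP K pi shat f T (X w)) => [n /andP[_ nm] _ before|tout] jn.
      by split=> [|j0]; [exact: leq_trans nm|apply: before; rewrite j0].
    by split=> // j0; apply: tout; rewrite j0 ltnW.
  have Nm : (Nstar K pi shat f T (X w) <= m)%N.
    by rewrite leqNgt; apply/negP => /running[]; rewrite ltnn.
  rewrite -(minn_idPr Nm) -sum_ltn_minn; apply: ler_sum => j _.
  rewrite indicE; case: ltnP => // jN; rewrite mem_set//=.
  have [_ nst] := running j jN; rewrite /B /= /late; case: ltnP => //= n0j.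
  have j0 : (0 < j)%N by exact: leq_trans n0j.
  rewrite ltNge; apply: contra (nst j0) => Dj.
  by apply: hst => //; exact: n0gt.
rewrite unlock; apply: (@le_trans _ _ (\int[P S]_w (\sum_(j < m) (\1_(B j) w)%:E)%E)%E).
  apply: ge0_le_integral => //.
  - apply/measurable_realfun.measurable_EFinP.
    have -> : (fun w => (Nstar K pi shat f T (X w))%:R : R) =
        (fun w => (fun z => (Nstar K pi shat f T (obs_extend y0 z))%:R)
           (first_obs m (X w))).
      by apply/funext => w; have [-> _] := test_finite_horizon K pi shat f T y0 (X w).
    exact: (measurable_obs_fun model
      (fun z => (Nstar K pi shat f T (obs_extend y0 z))%:R)).
  - apply: emeasurable_sum => j; apply/measurable_realfun.measurable_EFinP.
    exact: measurable_realfun.measurable_indic.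
  - by move=> w _; rewrite sumEFin lee_fin.
rewrite ge0_integral_sum//; last first.
  move=> j; apply/measurable_realfun.measurable_EFinP.
  exact: measurable_realfun.measurable_indic.
under eq_bigr do rewrite integral_indic// setIT.
apply: (@le_trans _ _ (\sum_(j < m) ((j < n0)%N%:R + C2 * j.+1%:R ^- 2)%:E)%E).
  apply: lee_sum => j _; case: ltnP => jn0.
    apply: le_trans (probability_le1 _ (mB j)) _.
    by rewrite lee_fin lerDl mulr_ge0 ?ltW// invr_ge0 exprn_ge0.
  rewrite add0r; apply: le_trans (hC2 _ _ _ _ model j S _ hS); last first.
    exact: leq_trans jn0.
  rewrite le_eqVlt; apply/orP; left; apply/eqP; congr (P S _).
  by apply/seteqP; split => w /=; rewrite /B /late /= ltnNge jn0.
rewrite sumEFin lee_fin big_split/= -mulr_sumr sum_ltn_minn.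
apply: (@le_trans _ _ (q + 1 + C2 * 2)); last by rewrite /q mulrDl; lra.
apply: lerD; last by rewrite ler_pM2l// sum_inv_sqr1.
by apply: le_trans n0le; rewrite ler_nat geq_minr.
Qed.

Lemma Pmax_bound (c T0 : R) : 0 < c ->
  exists2 C : R, 1 < C &
  forall (f : R -> R) (shat : estimator Y M),
    grows_TlnT c T0 f -> argmin_estimator K pi shat ->
  forall (d : measure_display) (Omega : measurableType d)
    (P : {set 'I_M} -> probability Omega R) (X : Omega -> obs_path Y M),
    outlier_model K mu pi P X ->
  forall T, 0 < T -> Pmax K P X (dstar K pi shat f T) <= C / T.
Proof.
move=> c0.
have /choice[C hC] : forall S, exists C : R, 0 < C /\ (hyps K S ->
  forall (f : R -> R) (shat : estimator Y M),
    grows_TlnT c T0 f -> argmin_estimator K pi shat ->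
  forall (d : measure_display) (Omega : measurableType d)
    (P : {set 'I_M} -> probability Omega R) (X : Omega -> obs_path Y M),
    outlier_model K mu pi P X ->
  forall T, 0 < T ->
    fine (P S [set w | dstar K pi shat f T (X w) != S]) <= C / T).
  move=> S; have [hS|] := boolP (hyps K S); last by exists 1.
  have [C C0 h] := prob_error_bound dmu dpi fmu fpi mu_neq_pi M1 K0 T0 hS c0.
  by exists C.
have Cge0 S : 0 <= C S by case: (hC S) => /ltW.
have s0 (Q : pred {set 'I_M}) : 0 <= \sum_(S | Q S) C S by exact: sumr_ge0.
exists (2 + \sum_S C S); first by have := s0 predT; lra.
move=> f shat gf hshat d Omega P X model T Tp.
apply/bigmax_leP; split; first by rewrite divr_ge0 ?(ltW Tp)// addr_ge0.
move=> S hS; have [_ h] := hC S.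
apply: le_trans (h hS f shat gf hshat _ _ _ _ model T Tp) _.
rewrite ler_pM2r ?invr_gt0// (bigD1 S)//=.
by have := s0 [pred S' | S' != S]; rewrite /=; lra.
Qed.

End SampleSize.

(** * Asymptotics *)

Section Asymptotics.
Variable R : realType.

Lemma near_pinfty (A : R -> Prop) (t : R) : (forall T, t < T -> A T) ->
  \forall T \near +oo, A T.
Proof. by move=> h; exists t; split; [exact: num_real|]. Qed.

Lemma cvg0_pinfty (h : R -> R) :
  (forall e, 0 < e -> exists t, forall T, t < T -> `|h T| <= e) ->
  h T @[T --> +oo] --> (0 : R).
Proof.
move=> H; apply/cvgr0Pnorm_le => e e0; have [t ht] := H e e0.
exact: near_pinfty ht.
Qed.

Lemma lt_ln_of_expR (x T : R) : expR x < T -> x < ln T.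
Proof.
move=> h; have T0 := lt_trans (expR_gt0 x) h.
by rewrite -{1}(expRK x) ltr_ln ?posrE ?expR_gt0.
Qed.

Lemma cvg_bound_over_ln (k : R) : k / (ln T - k) @[T --> +oo] --> (0 : R).
Proof.
apply: cvg0_pinfty => e e0; exists (expR (k + `|k| / e)) => T /lt_ln_of_expR h.
have k0 : 0 <= `|k| / e by rewrite divr_ge0// ltW.
have d0 : 0 < ln T - k by lra.
rewrite normrM normfV (ger0_norm (ltW d0)) ler_pdivrMr// mulrC -ler_pdivrMr//.
lra.
Qed.


(** Bounds [ln T / b + C] for all [b < a] amount to [ln T / a * (1 + o(1))]. *)
Lemma asymptotic_size (a : R) (E : R -> R) : 0 < a ->
  (forall b, 0 < b < a -> exists C : R, forall T, 1 <= T -> E T <= ln T / b + C) ->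
  exists eps : R -> R, [/\ eps T @[T --> +oo] --> (0 : R),
    forall T, 0 <= eps T & forall T, 1 < T -> E T <= ln T / a * (1 + eps T)].
Proof.
move=> a0 hE; exists (fun T => Order.max 0 (E T * a / ln T - 1)); split.
- apply: cvg0_pinfty => e e0.
  pose b := a / (1 + e / 2).
  have s0 : 0 < 1 + e / 2 by rewrite addr_gt0// divr_gt0.
  have b0 : 0 < b by rewrite divr_gt0.
  have ba : b < a by rewrite /b ltr_pdivrMr// ltr_pMr// ltrDl divr_gt0.
  have [|C hC] := hE b; first by rewrite b0 ba.
  have k0 : 0 <= `|C| * a * 2 / e by rewrite !mulr_ge0// ?invr_ge0 ltW.
  exists (expR (`|C| * a * 2 / e)) => T hT.
  have T1 : 1 < T.
    by apply: le_lt_trans hT; rewrite -[leLHS]expR0 ler_expR.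
  have lT : `|C| * a * 2 / e < ln T by exact: lt_ln_of_expR.
  have l0 : 0 < ln T by exact: le_lt_trans lT.
  rewrite ger0_norm ?le_max ?lexx// ge_max (ltW e0)/= lerBlDr ler_pdivrMr//.
  apply: (@le_trans _ _ ((ln T / b + `|C|) * a)).
    rewrite ler_pM2r//; apply: le_trans (hC T (ltW T1)) _.
    by rewrite lerD2l ler_norm.
  have -> : (ln T / b + `|C|) * a = ln T * (1 + e / 2) + `|C| * a.
    by rewrite /b invf_div; field; rewrite gt_eqF.
  by move: lT; rewrite ltr_pdivrMr//; lra.
- by move=> T; rewrite le_max lexx.
- move=> T T1; have l0 : 0 < ln T by apply: ln_gt0.
  have {1}-> : E T = ln T / a * (1 + (E T * a / ln T - 1)).
    by field; rewrite !gt_eqF.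
  by rewrite ler_pM2l ?divr_gt0// lerD2l le_max lexx orbT.
Qed.

End Asymptotics.

Theorem theorem2 (R : realType) (Y : finType) (M K : nat)
    (hM : (3 <= M)%N) (hK : (2 < K)%N) (hKM : (2 * K < M)%N) :
  (forall (f : R -> R) (shat : (Y -> R) -> estimator Y M),
     (exists c T0 : R, 0 < c /\ grows_TlnT c T0 f) ->
     (forall pi : Y -> R, is_dist pi -> full_support pi ->
        argmin_estimator K pi (shat pi)) ->
     universally_consistent K (fun pi T => dstar K pi (shat pi) f T))
  /\
  (forall mu pi : Y -> R,
     is_dist mu -> is_dist pi -> full_support mu -> full_support pi ->
     mu <> pi ->
   forall c T0 : R, 0 < c ->
   exists C : R,
   forall (f : R -> R) (shat : estimator Y M),
     grows_TlnT c T0 f ->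
     argmin_estimator K pi shat ->
   forall (d : measure_display) (Omega : measurableType d)
     (P : {set 'I_M} -> probability Omega R) (X : Omega -> obs_path Y M),
     outlier_model K mu pi P X ->
   let Perr (T : R) := Pmax K P X (dstar K pi shat f T) in
   (forall T : R, 0 < T -> Perr T <= C / T)
   /\
   (forall S : {set 'I_M}, nonnull K S ->
      (0 < alpha_S K mu pi S)%E /\
      exists eps1 eps2 : R -> R,
        eps1 T @[T --> +oo] --> (0 : R) /\
        eps2 T @[T --> +oo] --> (0 : R) /\
        \forall T \near +oo,
          ('E_(P S)[fun w => (Nstar K pi shat f T (X w))%:R]
             <= (ln T / fine (alpha_S K mu pi S) * (1 + eps1 T))%:E)%E /\
          ln T / fine (alpha_S K mu pi S) * (1 + eps1 T)
             <= - ln (Perr T)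
                / fine (if #|S| == K then KL mu pi
                        else Order.min (KL mu pi) (eta_S mu pi S))
                * (1 + eps2 T))).
Proof.
have M1 : (1 < M)%N by apply: leq_trans hM.
have K0 : (0 < K)%N by apply: leq_trans hK.
split.
  move=> f shat [c [T0 [c0 gf]]] hshat mu pi dmu dpi fmu fpi ne d Omega P X model.
  have [C C1 hC] := Pmax_bound dmu dpi fmu fpi ne M1 K0 T0 c0.
  apply: cvg0_pinfty => e e0; exists (C / e) => T hT.
  have T0' : 0 < T by apply: le_lt_trans hT; rewrite divr_ge0//; lra.
  rewrite ger0_norm; last exact/ltW/(Pmax_gt0 dmu dpi fmu fpi ne M1 K0 model).
  apply: le_trans (hC f (shat pi) gf (hshat pi dpi fpi) _ _ _ _ model T T0') _.
  by rewrite ler_pdivrMr// mulrC -ler_pdivrMr// ltW.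
move=> mu pi dmu dpi fmu fpi ne c T0 c0.
have [C C1 hC] := Pmax_bound dmu dpi fmu fpi ne M1 K0 T0 c0.
exists C => f shat gf hshat d Omega P X model Perr.
have hPerr T : 0 < T -> Perr T <= C / T.
  exact: (hC f shat gf hshat _ _ _ _ model T).
split=> // S nS; have /andP[_ S0] := nS.
have [afin a0] := alpha_S_fin dmu dpi fmu fpi M1 K0 ne nS.
split=> //.
set a := fine (alpha_S K mu pi S).
have ap : 0 < a by rewrite /a fine_gt0// a0 -ge0_fin_numE ?ltW.
set D := fine (if _ then _ else _).
have rfin := rate_S_fin K dmu dpi fpi ne S0.
have Dp : 0 < D.
  have r0 := rate_S_gt0 K dmu dpi ne S0.
  by rewrite -lte_fin fineK.
have Da : D <= a by rewrite fine_le// rate_S_le_alpha.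
pose E T := fine 'E_(P S)[fun w => (Nstar K pi shat f T (X w))%:R].
have hE b : 0 < b < a -> exists C' : R, forall T, 1 <= T ->
    ('E_(P S)[fun w => (Nstar K pi shat f T (X w))%:R] = (E T)%:E)%E /\
    E T <= ln T / b + C'.
  move=> hb; have [C' hC'] := expected_size_bound dmu dpi fmu fpi ne M1 K0 nS hb.
  exists C' => T T1; have le := hC' f shat hshat _ _ _ _ model T T1.
  have EE : ('E_(P S)[fun w => (Nstar K pi shat f T (X w))%:R] = (E T)%:E)%E.
    rewrite fineK// ge0_fin_numE ?expectation_ge0//.
    by apply: le_lt_trans le _; rewrite ltry.
  by split=> //; rewrite -lee_fin -EE.
have [eps1 [e10 e1ge hE1]] : exists eps : R -> R,
    [/\ eps T @[T --> +oo] --> (0 : R),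
    forall T, 0 <= eps T & forall T, 1 < T -> E T <= ln T / a * (1 + eps T)].
  apply: asymptotic_size => // b hb; have [C' hC'] := hE b hb.
  by exists C' => T /hC'[].
exists eps1, (fun T => (1 + eps1 T) * (1 + ln C / (ln T - ln C)) - 1); split=> //.
split.
  rewrite (_ : 0 = (1 + 0) * (1 + 0) - 1 :> R); last by rewrite addr0 mulr1 subrr.
  apply: cvgB; last exact: cvg_cst.
  apply: cvgM; apply: cvgD => //; try exact: cvg_cst.
  exact: cvg_bound_over_ln.
have lC0 : 0 < ln C by exact: ln_gt0.
apply: (@near_pinfty _ _ (expR (ln C))) => T hT.
have lT : ln C < ln T by exact: lt_ln_of_expR.
have T1 : 1 < T by apply: lt_trans hT; rewrite -[ltLHS]expR0 ltr_expR.
have Tp : 0 < T by exact: lt_trans T1.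
split.
  have [|C' hC'] := hE (a / 2); first by apply/andP; split; lra.
  by have [-> _] := hC' T (ltW T1); rewrite lee_fin hE1.
have Pp : 0 < Perr T by exact: (Pmax_gt0 dmu dpi fmu fpi ne M1 K0 model).
have lnP : ln T - ln C <= - ln (Perr T).
  rewrite lerNr opprB -ln_div ?posrE//; last lra.
  by rewrite ler_ln ?posrE ?divr_gt0 ?hPerr//; lra.
have d0 : 0 < ln T - ln C by rewrite subr_gt0.
have -> : 1 + ((1 + eps1 T) * (1 + ln C / (ln T - ln C)) - 1) =
    (1 + eps1 T) * (ln T / (ln T - ln C)).
  by field; rewrite gt_eqF.
have e1 : 0 <= 1 + eps1 T by rewrite addr_ge0.
apply: (@le_trans _ _ (ln T / D * (1 + eps1 T))).
  by rewrite ler_wpM2r// ler_wpM2l ?lef_pV2// ltW//; lra.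
have -> : ln T / D = (ln T - ln C) / D * (ln T / (ln T - ln C)).
  by field; rewrite !gt_eqF.
rewrite -mulrA [X in _ * X <= _]mulrC ler_wpM2r//.
  by rewrite mulr_ge0// divr_ge0 ?ltW//; lra.
by rewrite ler_pM2r ?invr_gt0.
Qed.
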